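(* Let $g$, $r$ and $d$ be nonnegative integers. The function taking a metric graph $\Gamma$ to its Brill-Noether rank $w^r_d(\Gamma)$ is upper semicontinuous on the moduli space $M_g^{\mathrm{met}}$ of metric graphs of genus $g$; that is, $\{\Gamma : w^r_d(\Gamma) < \rho\}$ is open in $M_g^{\mathrm{met}}$ for every integer $\rho$.
   Context: Metric graphs. A metric graph is a compact connected metric space obtained from a finite connected graph (loops and multiple edges allowed) by assigning a positive real length to each edge. Its genus $g$ is its first Betti number. Divisors. A divisor on a metric graph $\Gamma$ is a finite $\mathbb{Z}$-linear combination of points of $\Gamma$; its degree is the sum of its coefficients; it is effective if all its coefficients are nonnegative. For a continuous piecewise linear function $f$ on $\Gamma$ with integer slopes, $\mathrm{div}(f) = \sum_{v \in \Gamma} \mathrm{ord}_v(f)\, v$, where $\mathrm{ord}_v(f)$ is the sum of the incoming slopes of $f$ at $v$; such divisors are called principal. Two divisors are equivalent if their difference is principal. $\mathrm{Pic}_d(\Gamma)$ is the set of equivalence classes of divisors of degree $d$. Rank. The rank $r(D)$ of a divisor $D$ is $-1$ if $D$ is not equivalent to an effective divisor, and otherwise is the largest integer $r$ such that for every effective divisor $E$ of degree $r$ on $\Gamma$ there is a divisor $D'$ equivalent to $D$ with $D' - E$ effective. The rank depends only on the class $[D]$. Brill-Noether locus. $W^r_d(\Gamma) \subset \mathrm{Pic}_d(\Gamma)$ is the set of divisor classes of degree $d$ and rank at least $r$. Brill-Noether rank. If $W^r_d(\Gamma)$ is nonempty, $w^r_d(\Gamma)$ is the largest integer $\rho$ such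 that, for every effective divisor $E$ of degree $r + \rho$ on $\Gamma$, there exists a divisor $D$ of degree $d$ and rank at least $r$ on $\Gamma$ such that $D - E$ is effective. If $W^r_d(\Gamma)$ is empty then $w^r_d(\Gamma) = -1$. Moduli space. Consider finite connected graphs $G$ of genus $g$ all of whose vertices have valence at least $3$, a loop counting twice (for $g=1$ one takes instead only the graph with one vertex and one loop, and for $g=0$ only the single vertex). For such $G$ with edges $e_1, \dots, e_n$, let $\sigma^*_G \subset \mathbb{R}_{\geq 0}^n$ be the set of $\ell = (\ell_1,\dots,\ell_n)$ such that the edges $e_i$ with $\ell_i = 0$ contain no cycle, with the subspace topology. To $\ell \in \sigma^*_G$ is associated the metric graph $\Gamma_\ell$ of genus $g$ obtained by giving $e_i$ length $\ell_i$, edges of length $0$ being contracted. The moduli space $M_g^{\mathrm{met}}$ is the set of isometry classes of all such metric graphs $\Gamma_\ell$, with the finest topology for which all the maps $\sigma^*_G \to M_g^{\mathrm{met}}$, $\ell \mapsto [\Gamma_\ell]$, are continuous (i.e. the colimit of the cones $\sigma^*_G$). *)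

(* Defs.v *)
From HB Require Import structures.
From mathcomp Require Import all_boot all_order all_algebra.
From mathcomp Require Import all_classical all_reals all_analysis.
From mathcomp Require Export freeg.

Set Implicit Arguments.
Unset Strict Implicit.
Unset Printing Implicit Defensive.

Import Order.TTheory GRing.Theory Num.Theory.
Import numFieldNormedType.Exports.

Local Open Scope classical_set_scope.
Local Open Scope ring_scope.

(** * Finite graphs (loops and multiple edges allowed) *)

(* The orientation src/tgt of each edge is an arbitrary choice. *)
Record graph := Graph {
  vertex : finType;
  edge : finType;
  src : edge -> vertex;
  tgt : edge -> vertex }.

Section Graphs.
Variable G : graph.

(* Adjacency through an edge satisfying P. *)
Definition adj_by (P : pred (edge G)) : rel (vertex G) := fun u v =>
  [exists e, P e && (((src e == u) && (tgt e == v)) ||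
                     ((src e == v) && (tgt e == u)))].

Definition connected_graph : Prop :=
  (0 < #|vertex G|)%N /\ forall u v, connect (adj_by predT) u v.

(* A loop contributes to both summands. *)
Definition valence (v : vertex G) : nat :=
  (#|[set e | src e == v]%SET| + #|[set e | tgt e == v]%SET|)%N.

(* The simplicial boundary C_1 -> C_0 (acting on row vectors); the first Betti
   number is the dimension of its kernel. *)
Definition boundary : 'M[rat]_(#|edge G|, #|vertex G|) :=
  \matrix_(i, j) ((tgt (enum_val i) == enum_val j)%:R
                  - (src (enum_val i) == enum_val j)%:R).

Definition genus : nat := \rank (kermx boundary).

(* Darts: edges with a direction of traversal ([true] is from src to tgt). *)
Definition dart_src (a : edge G * bool) := if a.2 then src a.1 else tgt a.1.
Definition dart_tgt (a : edge G * bool) := if a.2 then tgt a.1 else src a.1.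

(* Loops are cycles of length 1, pairs of parallel edges cycles of length 2. *)
Definition graph_cycle (c : seq (edge G * bool)) : bool :=
  [&& c != [::], cycle (fun a b => dart_tgt a == dart_src b) c,
      uniq (map fst c) & uniq (map dart_src c)].

Lemma adj_by_sym (P : pred (edge G)) : symmetric (adj_by P).
Proof. by move=> u v; apply: eq_existsb => e; rewrite orbC. Qed.

Lemma adj_by_connect_sym (P : pred (edge G)) : connect_sym (adj_by P).
Proof. exact/sym_connect_sym/adj_by_sym. Qed.

End Graphs.

(** * Metric graphs *)

Record metric_graph (R : realType) := MetricGraph {
  mgraph :> graph;
  mgraph_connected : connected_graph mgraph;
  len : edge mgraph -> R;
  len_gt0 : forall e, 0 < len e }.

Section MetricGraphs.
Variables (R : realType) (Gam : metric_graph R).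

(* A point is either a vertex or a pair (e, t) with t in the open interval
   ]0, len e[. *)
Definition is_point (x : vertex Gam + edge Gam * R) : bool :=
  if x is inr (e, t) then 0 < t < len e else true.

Record point := Point { point_val : vertex Gam + edge Gam * R;
                        _ : is_point point_val }.

HB.instance Definition _ := [isSub for point_val].
HB.instance Definition _ := [Choice of point by <:].

Definition vpt (v : vertex Gam) : point := @Point (inl v) isT.

(* The point at distance t from src e along e, for t in [0, len e]; the two
   ends of the interval are glued to the endpoints of e. *)
Definition ept (e : edge Gam) (t : R) : point :=
  if t <= 0 then vpt (src e) else insubd (vpt (tgt e)) (inr (e, t)).

(* The same, with e traversed in either direction. *)
Definition dpt (a : edge Gam * bool) (t : R) : point :=
  ept a.1 (if a.2 then t else len a.1 - t).

(* The path metric: the infimum of the lengths of the chains of segments lying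
   on edges; (e, (t, u)) is the segment of e between parameters t and u. *)
Fixpoint chain (x : point) (c : seq (edge Gam * (R * R))) (y : point) : Prop :=
  match c with
  | [::] => x = y
  | (e, (t, u)) :: c' => [/\ 0 <= t <= len e, 0 <= u <= len e, ept e t = x
                           & chain (ept e u) c' y]
  end.

Definition chain_length (c : seq (edge Gam * (R * R))) : R :=
  \sum_(s <- c) `|s.2.2 - s.2.1|.

Definition mdist (x y : point) : R :=
  inf [set chain_length c | c in [set c | chain x c y]].

(** ** Divisors *)

Definition divisor := {freeg point}.

Definition effective (D : divisor) : Prop := fgle 0 D.

(* Continuous piecewise linear functions with integer slopes. Continuity holds
   because the pieces are closed and an edge meets its endpoints at the ends of
   its parameter interval. *)
Definition int_pl (f : point -> R) : Prop :=
  forall e : edge Gam, exists s : seq R, itv_partition 0 (len e) s /\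
    forall i, (i < size s)%N -> exists k : int,
      forall t, nth 0 (0 :: s) i <= t <= nth 0 s i ->
        f (ept e t)
        = f (ept e (nth 0 (0 :: s) i)) + k%:~R * (t - nth 0 (0 :: s) i).

(* k is the slope of f towards x along the dart a: a starts at or passes
   through x (at parameter t, unique when it exists, as t < len), and f
   increases at rate k when approaching x from the rest of a. *)
Definition incoming_slope (f : point -> R) (x : point) (a : edge Gam * bool)
    (k : int) : Prop :=
  exists t, [/\ 0 <= t < len a.1, dpt a t = x &
    \forall h \near 0^'+, f x = f (dpt a (t + h)) + k%:~R * h].

(* The tangent directions at x correspond to the darts that start at or pass
   through x; the other darts contribute 0. *)
Definition ord (f : point -> R) (x : point) : int :=
  \sum_(a : edge Gam * bool) xget 0 [set k | incoming_slope f x a k].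

Definition principal (D : divisor) : Prop :=
  exists2 f, int_pl f & forall x, coeff x D = ord f x.

Definition equivalent (D D' : divisor) : Prop := principal (D - D').

Definition divisor_class (D : divisor) : set divisor :=
  [set D' | equivalent D' D].

(** ** Rank and Brill-Noether rank *)

Definition largest (A : set int) : int := xget 0 (A `&` ubound A).

Definition rank (D : divisor) : int :=
  if `[< exists2 D', equivalent D' D & effective D' >] then
    largest [set r | forall E, effective E -> deg E = r ->
                       exists2 D', equivalent D' D & effective (D' - E)]
  else -1.

(* W^r_d, a subset of Pic_d *)
Definition bn_locus (r d : nat) : set (set divisor) :=
  [set divisor_class D | D in [set D | deg D = d%:Z /\ r%:Z <= rank D]].

Definition bn_rank (r d : nat) : int :=
  if `[< bn_locus r d !=set0 >] then
    largest [set rho | forall E, effective E -> deg E = r%:Z + rho ->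
      exists D, [/\ deg D = d%:Z, r%:Z <= rank D & effective (D - E)]]
  else -1.

End MetricGraphs.

Definition isometric (R : realType) (Gam Gam' : metric_graph R) : Prop :=
  exists2 phi : point Gam -> point Gam', bijective phi &
    forall x y, mdist (phi x) (phi y) = mdist x y.

(** * Contraction of the edges of length zero *)

Section Contraction.
Variables (R : realType) (G : graph) (l : edge G -> R).
Hypothesis G_connected : connected_graph G.

Let zero_adj := adj_by (fun e => l e == 0).

(* The vertices of the contraction are the connected components of the subgraph
   of edges of length zero, given by their representatives under [root]. *)
Definition cvertex : finType := {v : vertex G | roots zero_adj v}.
Definition cedge : finType := {e : edge G | 0 < l e}.

Definition component (v : vertex G) : cvertex :=
  exist _ (fingraph.root zero_adj v) (roots_root (adj_by_connect_sym _) v).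

Definition contraction : graph :=
  @Graph cvertex cedge (fun e => component (src (val e)))
                       (fun e => component (tgt (val e))).

Hypothesis l_ge0 : forall e, 0 <= l e.

Lemma contraction_connected : connected_graph contraction.
Proof.
case: G_connected => /card_gt0P[v0 _] conG; split.
  by apply/card_gt0P; exists (component v0).
have step u v : adj_by predT u v ->
    connect (@adj_by contraction predT) (component u) (component v).
  move=> /existsP[e /= uv].
  have [le0|le0] := eqVneq (l e) 0.
    suff -> : component u = component v by exact: connect0.
    apply/val_inj => /=; apply/eqP.
    rewrite (root_connect (adj_by_connect_sym _)); apply: connect1.
    by apply/existsP; exists e; rewrite le0 eqxx.
  have lgt : 0 < l e by rewrite lt_neqAle eq_sym le0 l_ge0.
  apply: connect1; apply/existsP; exists (exist _ e lgt : cedge) => /=.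
  by case/orP: uv => /andP[/eqP-> /eqP->]; rewrite !eqxx ?orbT.
have walk u v : connect (adj_by predT) u v ->
    connect (@adj_by contraction predT) (component u) (component v).
  case/connectP => p; elim: p u => [|w p IH] u /=; first by move=> _ ->.
  by case/andP => /step uw /IH/[apply]; exact: connect_trans.
have repK (u : cvertex) : component (val u) = u.
  by apply/val_inj => /=; case: u => u /= /eqP.
by move=> u v; rewrite -(repK u) -(repK v); exact: walk.
Qed.

Definition contracted_metric_graph : metric_graph R :=
  @MetricGraph R contraction contraction_connected
    (fun e => l (val e)) (fun e => valP e).

End Contraction.

(** * The moduli space of metric graphs of genus g *)

(* Graphs with numbered vertices and edges, so that they form a set; every
   finite graph is isomorphic to one of these. *)
Definition numbered_graph (n m : nat) (ends : 'I_m -> 'I_n * 'I_n) : graph :=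
  @Graph 'I_n 'I_m (fun e => (ends e).1) (fun e => (ends e).2).

Definition is_stable (g : nat) (G : graph) : Prop :=
  [/\ connected_graph G, genus G = g &
    match g with
    | 0 => #|vertex G| = 1%N /\ #|edge G| = 0%N
    | 1 => #|vertex G| = 1%N /\ #|edge G| = 1%N
    | _ => forall v : vertex G, (3 <= valence v)%N
    end].

Record stable_graph (g : nat) := StableGraph {
  nb_vertex : nat;
  nb_edge : nat;
  ends : 'I_nb_edge -> 'I_nb_vertex * 'I_nb_vertex;
  stable_graphP : is_stable g (numbered_graph ends) }.

Lemma stable_graph_connected g (G : stable_graph g) :
  connected_graph (numbered_graph (@ends g G)).
Proof. by have [] := stable_graphP G. Qed.

HB.instance Definition _ g := gen_eqMixin (stable_graph g).
HB.instance Definition _ g := gen_choiceMixin (stable_graph g).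

Section Moduli.
Variables (R : realType) (g : nat).

(* sigma^*_G; as a type, it carries the subspace topology of R^n. *)
Definition cone (G : stable_graph g) : set 'rV[R]_(nb_edge G) :=
  [set l | (forall e, 0 <= l 0 e) /\
     forall c : seq (edge (numbered_graph (@ends g G)) * bool),
       graph_cycle c -> has (fun a => l 0 a.1 != 0) c].
Arguments cone : clear implicits.

Lemma cone_ge0 (G : stable_graph g) (l : cone G) e : 0 <= set_val l 0 e.
Proof. by have [+ _] := set_valP l; apply. Qed.

(* The metric graph Gamma_l. *)
Definition cone_graph (G : stable_graph g) (l : cone G) : metric_graph R :=
  @contracted_metric_graph R (numbered_graph (@ends g G))
    (fun e => set_val l 0 e) (stable_graph_connected G) (cone_ge0 l).

(* The disjoint union of the cones. *)
Definition cones := {G : stable_graph g & (cone G : Type)}.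
HB.instance Definition _ := Topological.on cones.

Definition cones_graph (p : cones) : metric_graph R := cone_graph (projT2 p).

Definition cones_isometric : rel cones :=
  fun p q => `[< isometric (cones_graph p) (cones_graph q) >].

Lemma cones_isometric_equiv : equiv_class_of cones_isometric.
Proof.
split=> [p|p q|q p s].
- by apply/asboolP; exists id => //; exists id.
- by apply/asbool_equiv_eq; split=> -[f [h fK hK] fd];
    exists h; [exists f| |exists f|] => // x y; rewrite -fd !hK.
- move=> /asboolP[f fb fd] /asboolP[h hb hd]; apply/asboolP.
  by exists (h \o f); [exact: bij_comp|move=> x y /=; rewrite hd fd].
Qed.

Canonical cones_isometric_equivRel := EquivRelPack cones_isometric_equiv.

(* The set of isometry classes of the graphs Gamma_l. The quotient topology of
   the disjoint union of the cones is the finest one for which all the maps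
   from the cones are continuous (see [Mg_met_openP]). *)
Definition Mg_met := quotient_topology {eq_quot cones_isometric}%qT.
HB.instance Definition _ := Topological.on Mg_met.
HB.instance Definition _ := Quotient.on Mg_met.

Definition cone_map (G : stable_graph g) (l : cone G) : Mg_met :=
  (\pi_Mg_met (existT (fun G => cone G : Type) G l))%qT.

Lemma Mg_met_openP (U : set Mg_met) :
  open U <-> forall G, open (@cone_map G @^-1` U).
Proof. exact: sigT_openP. Qed.

(* The Brill-Noether rank as a function on isometry classes, computed on a
   representative: mathematically it does not depend on this choice, as w^r_d
   is defined from the metric structure alone. *)
Definition Mg_bn_rank (r d : nat) : Mg_met -> int :=
  lift_fun1 Mg_met (fun p => bn_rank (cones_graph p) r d).

End Moduli.

(* Main.v *)
(** A linear equivalence of sums of points X and Y on a metric graph is encoded by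
    finitely many data: real values at the vertices and an integer slope on each
    edge, subject to one equation per edge, linear in the edge lengths and in the
    positions of the points, and to a conservation law for the slopes. The slopes
    are bounded in terms of the number of points only (a cut argument), so along
    an ultrafilter of length vectors converging to l they are eventually constant
    while the points converge, and the limit is again such a certificate. The
    equations make sense on the graph G before the edges of length zero are
    contracted. Given E on Gamma_l, transport it to the nearby graphs, choose there
    D = E + F of rank at least r, and let F converge: every effective E' of degree r
    gives D ~ E' + F' on the nearby graphs, hence also in the limit. So
    w^r_d >= rho is a closed condition on each cone; it descends to the moduli
    space because an isometry matches the germs of edges at corresponding points,
    hence slopes and principal divisors. *)
From mathcomp Require Import all_boot all_order all_algebra.
From mathcomp Require Import all_classical all_reals all_analysis.
From mathcomp Require Import zify lra ring.
Require Import Defs.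

Set Implicit Arguments.
Unset Strict Implicit.
Unset Printing Implicit Defensive.

Import Order.TTheory GRing.Theory Num.Theory.
Import numFieldNormedType.Exports.

Local Open Scope classical_set_scope.
Local Open Scope ring_scope.

(** * Points, tangent directions and piecewise linear functions *)

(** The graphs near Gamma_l are different spaces, with different sets of contracted edges, so
    neither their points nor their functions converge directly. A point is therefore recorded by its
    place on [G], and keeps this record when it tends to an end of its edge or when the edge shrinks
    to length zero. A slope bound involving the lengths would be lost on a shrinking edge. The slope
    on an edge that is already contracted is not determined by the edge equation at all; it is reset
    to 0 before limits are taken. An ultrafilter is convenient because F must be fixed before E' is
    known: the one along which F converges also makes each later F' converge, with no further
    refinement for each E'. For rho >= 0 all divisors involved contain effective ones, so lists of
    points suffice; for rho < 0 the bound w^r_d >= -1 is used, and there divisors that are not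
    effective occur. *)

Lemma real_induction (R : realType) (a b : R) (P : R -> Prop) :
  P a ->
  (forall t, a <= t < b -> (forall s, a <= s <= t -> P s) ->
    exists2 e, 0 < e & forall h, 0 < h <= e -> t + h <= b -> P (t + h)) ->
  (forall t, a < t <= b -> (forall s, a <= s < t -> P s) -> P t) ->
  forall t, a <= t <= b -> P t.
Proof.
move=> Pa Pright Pleft t0 /andP[at0 t0b].
have ab : a <= b by exact: le_trans t0b.
(* The supremum of [A] lies in [A] by the left hypothesis; if it were below [b], the right
   hypothesis would push [A] beyond it. *)
pose A := [set t | a <= t <= b /\ forall s, a <= s <= t -> P s].
have Aa : A a.
  by split=> [|s sa]; [lra|have -> : s = a by lra].
have ubA : ubound A b by move=> t [] /andP[].
have supA : has_sup A by split; [exists a|exists b].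
pose c := sup A.
have ac : a <= c by apply: ub_le_sup Aa; exists b.
have cb : c <= b by apply: ge_sup => //; exists a.
have Pc s : a <= s < c -> P s.
  move=> /andP[as_ sc].
  have [u [_ Pu] cu] := sup_adherent (eps := c - s) ltac:(lra) supA.
  by apply: Pu; rewrite as_ /=; move: cu; rewrite -/c; lra.
have Ac s : a <= s <= c -> P s.
  move=> asc; have [sc|sc] := ltP s c; first by apply: Pc; lra.
  have -> : s = c by lra.
  have [ac'|ca] := ltP a c; last by have -> : c = a by lra.
  by apply: Pleft => //; lra.
have [cb'|bc] := ltP c b; last by apply: Ac; lra.
have [||e e0 Pe] := Pright c; [lra|exact: Ac|].
pose h := Num.min e (b - c).
have h0 : 0 < h by rewrite lt_min; lra.
have he : h <= e by rewrite ge_min lexx.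
have hb : h <= b - c by rewrite ge_min lexx orbT.
suff /(ub_le_sup (ex_intro _ b ubA)) : A (c + h) by rewrite -/c; lra.
split=> [|s sch]; first lra.
have [sc|sc] := leP s c; first by apply: Ac; lra.
have -> : s = c + (s - c) by ring.
by apply: Pe; lra.
Qed.

Lemma near_at_right0P (R : realType) (P : R -> Prop) :
  (\forall h \near 0^'+, P h) <-> exists2 e, 0 < e & forall h, 0 < h <= e -> P h.
Proof.
split=> [[e /= e0 Pe]|[e e0 Pe]].
  exists (e / 2); first by rewrite divr_gt0.
  move=> h he; apply: Pe; last lra.
  by rewrite /= sub0r normrN gtr0_norm; lra.
exists e => //= h; rewrite /= sub0r normrN => he h0; apply: Pe.
by move: he; rewrite gtr0_norm //; lra.
Qed.

Section Points.
Variables (R : realType) (Gam : metric_graph R).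
Implicit Types (a b : edge Gam * bool) (e : edge Gam) (t h : R)
  (x y : point Gam) (f : point Gam -> R).

Lemma ept0 e : ept e 0 = vpt (src e).
Proof. by rewrite /ept lexx. Qed.

Lemma ept_len e : ept e (len e) = vpt (tgt e).
Proof.
rewrite /ept leNgt len_gt0 /= /insubd insubN //=.
by rewrite ltxx andbF.
Qed.

Lemma ept_inner e t : 0 < t < len e -> point_val (ept e t) = inr (e, t).
Proof.
by move=> et; rewrite /ept leNgt; case/andP: (et) => -> _ /=; rewrite insubdK.
Qed.

Lemma ept_inj e e' t t' : 0 < t < len e -> 0 < t' < len e' ->
  ept e t = ept e' t' -> e = e' /\ t = t'.
Proof.
by move=> /ept_inner et /ept_inner et' /(congr1 val) /=; rewrite et et' => -[].
Qed.

Lemma ept_neq_vpt e t v : 0 < t < len e -> ept e t <> vpt v.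
Proof. by move=> /ept_inner et /(congr1 val) /=; rewrite et. Qed.

Lemma vpt_inj : injective (@vpt R Gam).
Proof. by move=> u v /(congr1 val) [->]. Qed.

Variant point_spec : point Gam -> Prop :=
| PointVertex v : point_spec (vpt v)
| PointEdge e t of 0 < t < len e : point_spec (ept e t).

Lemma pointP x : point_spec x.
Proof.
case: x => -[v|[e t]] p.
  have -> : Point p = vpt v by exact: val_inj.
  exact: PointVertex.
have -> : Point p = ept e t by apply: val_inj; rewrite /= ept_inner.
exact: PointEdge.
Qed.

Lemma dpt0 a : dpt a 0 = vpt (dart_src a).
Proof.
by case: a => e [] /=; rewrite /dpt /dart_src /= ?subr0 ?ept0 ?ept_len.
Qed.

(** The darts leaving [x] are its tangent directions. Excluding [t = len a.1] counts each direction
    once: by a dart starting at a vertex, or by one of the two darts through an inner point. *)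
Definition arm x a t := 0 <= t < len a.1 /\ dpt a t = x.

Lemma arm_vpt v a t : arm (vpt v) a t <-> t = 0 /\ dart_src a = v.
Proof.
split=> [[/andP[t0 tl] at_]|[-> <-]]; last by rewrite /arm lexx len_gt0 dpt0.
move: t0; rewrite le_eqVlt => /orP[/eqP t0|t0].
  by move: at_; rewrite -t0 dpt0 => /vpt_inj.
by move: at_; rewrite /dpt; case: ifP => _ /ept_neq_vpt; case; lra.
Qed.

Lemma arm_ept e s a t : 0 < s < len e ->
  arm (ept e s) a t <-> a.1 = e /\ (if a.2 then t = s else t = len e - s).
Proof.
case: a => e' b es; split=> [[/= /andP[t0 tl] at_]|[/= ee']]; last first.
  subst e'; case: b => ->; rewrite /arm /dpt /=; first by split=> //; lra.
  by split; [lra|congr ept; ring].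
move: t0; rewrite le_eqVlt => /orP[/eqP t0|t0].
  by move: at_; rewrite -t0 dpt0 => /esym/(ept_neq_vpt es).
move: at_; rewrite /dpt /=.
by case: b => /ept_inj; (case=> [||ee' ts]; [lra|by []|subst e'; split=> //; lra]).
Qed.

Lemma arm_uniq x a t t' : arm x a t -> arm x a t' -> t = t'.
Proof.
case: (pointP x) => [v|e s es]; first by move=> /arm_vpt[-> _] /arm_vpt[].
by move=> /(arm_ept _ _ es)[_ +] /(arm_ept _ _ es)[_]; case: ifP => _ -> ->.
Qed.

(** The sign is that of [incoming_slope]: [k] is minus the derivative of [f] along the dart. *)
Definition slope_at f a t (k : int) :=
  exists2 d, 0 < d & forall h, 0 <= h <= d ->
    f (dpt a t) = f (dpt a (t + h)) + k%:~R * h.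

Lemma slope_atP f a t k : slope_at f a t k <->
  \forall h \near 0^'+, f (dpt a t) = f (dpt a (t + h)) + k%:~R * h.
Proof.
rewrite near_at_right0P; split=> -[d d0 fd]; exists d => // h hd.
  by apply: fd; lra.
have [->|h0] := eqVneq h 0; first by rewrite addr0 mulr0 addr0.
by apply: fd; lra.
Qed.

Lemma incoming_slopeP f x a k :
  incoming_slope f x a k <-> exists2 t, arm x a t & slope_at f a t k.
Proof.
split=> [[t [tl ax fk]]|[t [tl ax] /slope_atP fk]]; exists t => //.
  by apply/slope_atP; rewrite ax.
by split=> //; rewrite -ax.
Qed.

Lemma slope_at_uniq f a t k k' : slope_at f a t k -> slope_at f a t k' -> k = k'.
Proof.
move=> [d d0 fd] [d' d0' fd'].
pose h := Num.min d d'.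
have h0 : 0 < h by rewrite lt_min d0.
have hd : h <= d by rewrite ge_min lexx.
have hd' : h <= d' by rewrite ge_min lexx orbT.
have := fd h ltac:(lra); rewrite (fd' h ltac:(lra)).
by move=> /addrI/(mulIf (lt0r_neq0 h0))/intr_inj.
Qed.

Lemma xget_slope f x a t k : arm x a t -> slope_at f a t k ->
  xget 0 [set k | incoming_slope f x a k] = k.
Proof.
move=> ax fk; apply: xget_unique; first by apply/incoming_slopeP; exists t.
move=> k' /incoming_slopeP[t' ax' fk']; apply: slope_at_uniq fk' _.
by rewrite (arm_uniq ax' ax).
Qed.

Lemma xget_no_slope f x a : (forall t, ~ arm x a t) ->
  xget 0 [set k | incoming_slope f x a k] = 0.
Proof.
by move=> nax; apply: xgetPN => k /incoming_slopeP[t /nax].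
Qed.

Section Order.
Variables (f : point Gam -> R) (S : edge Gam * bool -> R -> int).
Hypothesis fS : forall a t, 0 <= t < len a.1 -> slope_at f a t (S a t).

Lemma ord_vpt v : ord f (vpt v) = \sum_(a | dart_src a == v) S a 0.
Proof.
rewrite /ord [RHS]big_mkcond /=; apply: eq_bigr => a _.
case: eqVneq => av.
  apply: (@xget_slope f _ a 0); first exact/arm_vpt.
  by apply: fS; rewrite lexx len_gt0.
by apply: xget_no_slope => t /arm_vpt[_ /eqP]; rewrite (negbTE av).
Qed.

Lemma ord_ept e t : 0 < t < len e ->
  ord f (ept e t) = S (e, true) t + S (e, false) (len e - t).
Proof.
move=> et; rewrite /ord (bigD1 (e, true)) //= (bigD1 (e, false)) /=; last first.
  by rewrite xpair_eqE andbF.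
rewrite addrA.
rewrite big1 ?addr0 => [|[e' b] /= ea]; last first.
  apply: xget_no_slope => t' /(arm_ept _ _ et)[/= ee']; subst e'.
  by move: ea; case: b; rewrite eqxx ?andbF.
congr (_ + _).
  by apply: (@xget_slope _ _ _ t); [apply/arm_ept|apply: fS => /=; lra].
by apply: (@xget_slope _ _ _ (len e - t)); [apply/arm_ept|apply: fS => /=; lra].
Qed.

End Order.

(** One-sided linearity in every direction, with no subdivision chosen: differences and isometries
    respect it directly, whereas [int_pl] would call for common refinements. *)
Definition loc_pl f := forall a t, 0 <= t < len a.1 -> exists k, slope_at f a t k.

Lemma dpt_true e t : dpt (e, true) t = ept e t.
Proof. by []. Qed.

Lemma dpt_false e t : dpt (e, false) t = ept e (len e - t).
Proof. by []. Qed.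

Lemma partition_pieceR (c L : R) s t : itv_partition c L s -> c <= t < L ->
  exists2 i, (i < size s)%N & nth 0 (c :: s) i <= t < nth 0 s i.
Proof.
case; elim: s c => [|u s IH] c /=; first by move=> _ /eqP <-; lra.
move=> /andP[cu us] lastL tL.
have [tu|ut] := ltP t u; first by exists 0%N => //=; lra.
have [|i is_ ti] := IH u us lastL; first lra.
by exists i.+1.
Qed.

Lemma partition_pieceL (c L : R) s t : itv_partition c L s -> c < t <= L ->
  exists2 i, (i < size s)%N & nth 0 (c :: s) i < t <= nth 0 s i.
Proof.
case; elim: s c => [|u s IH] c /=; first by move=> _ /eqP <-; lra.
move=> /andP[cu us] lastL tL.
have [tu|ut] := leP t u; first by exists 0%N => //=; lra.
have [|i is_ ti] := IH u us lastL; first lra.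
by exists i.+1.
Qed.

Lemma int_pl_loc_pl f : int_pl f -> loc_pl f.
Proof.
move=> fpl [e [] t] /= tL; have [s [sP fs]] := fpl e.
  have [i is_ ti] := partition_pieceR sP tL.
  have [k fk] := fs i is_; exists (- k).
  exists (nth 0 s i - t) => [|h hd]; first lra.
  by rewrite !dpt_true (fk t) ?(fk (t + h)) ?mulrNz; [ring|lra|lra].
have [|i is_ ti] := partition_pieceL (t := len e - t) sP; first lra.
have [k fk] := fs i is_; exists k.
exists (len e - t - nth 0 (0 :: s) i) => [|h hd]; first lra.
by rewrite !dpt_false (fk (len e - t)) ?(fk (len e - (t + h))); [ring|lra|lra].
Qed.

(** Real induction on [u] for the existence of a finite linear partition of [0, u]. The forward dart
    at [t] adds a piece beyond [t]; the backward dart adds one ending at [t], so breakpoints cannot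
    accumulate there. *)
Lemma loc_pl_int_pl f : loc_pl f -> int_pl f.
Proof.
move=> floc e.
pose linear_on u w := exists k : int, forall t, u <= t <= w ->
  f (ept e t) = f (ept e u) + k%:~R * (t - u).
pose P u := exists s : seq R, itv_partition 0 u s /\
  forall i, (i < size s)%N -> linear_on (nth 0 (0 :: s) i) (nth 0 s i).
have extend u w : P u -> u < w -> linear_on u w -> P w.
  move=> [s [[s_path /eqP s_last] s_lin]] uw uw_lin; exists (rcons s w); split.
    by split; rewrite ?last_rcons // rcons_path s_path s_last.
  move=> i; rewrite size_rcons ltnS -rcons_cons !nth_rcons /=.
  rewrite leq_eqVlt => /orP[/eqP ->|is_].
    by rewrite ltnn eqxx ltnSn (nth_last 0 (0 :: s)) /= s_last.
  by rewrite is_ ltnW ?ltnS //; exact: s_lin.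
apply: (@real_induction _ 0 (len e) P); last by rewrite lexx ltW ?len_gt0.
- by exists [::]; split.
- move=> t tL Pt; have [k [d d0 fk]] := floc (e, true) t tL.
  exists d => // h hd _; apply: (extend t); [by apply: Pt; lra|lra|].
  exists (- k) => u tu; have := fk (u - t) ltac:(lra).
  rewrite !dpt_true mulrNz (_ : t + (u - t) = u); last ring.
  by move=> ->; ring.
- move=> t tL Pt; have [|k [d d0 fk]] := floc (e, false) (len e - t).
    by rewrite /=; lra.
  pose h := Num.min d (t / 2).
  have h0 : 0 < h by rewrite lt_min; lra.
  have hd : h <= d by rewrite ge_min lexx.
  have ht : h <= t / 2 by rewrite ge_min lexx orbT.
  apply: (extend (t - h)); [by apply: Pt; lra|lra|].
  exists k => u tu; have := fk (t - u) ltac:(lra); have := fk h ltac:(lra).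
  rewrite !dpt_false (_ : len e - (len e - t) = t); last ring.
  rewrite (_ : len e - (len e - t + h) = t - h); last ring.
  rewrite (_ : len e - (len e - t + (t - u)) = u); last ring.
  by move=> -> /(canLR (addrK _)) <-; ring.
Qed.

Definition lin_eq (X Y : seq (point Gam)) : Prop :=
  exists2 f, int_pl f &
    forall x, ord f x = (count_mem x X)%:Z - (count_mem x Y)%:Z.

End Points.

(** * Certificates of linear equivalence *)

Section Certificate.
Variables (R : realType) (G : graph) (l : edge G -> R).

(* The ends of an edge may also be represented on the edge. *)
Definition rep : Type := (vertex G + edge G * R)%type.

Definition rep_valid (z : rep) : bool :=
  if z is inr (e, t) then 0 <= t <= l e else true.

Definition net (V : zmodType) (X Y : seq rep) (h : rep -> V) : V :=
  \sum_(z <- X) h z - \sum_(z <- Y) h z.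

Definition head_value (psi : vertex G -> int) (z : rep) : int :=
  match z with inl v => psi v | inr (e, _) => psi (tgt e) end.

(** A point at [t] changes the slope by 1 on the rest of [e], hence the value at the target by the
    remaining length. *)
Definition rest (e : edge G) (z : rep) : R :=
  if z is inr (e', t) then if e' == e then l e - t else 0 else 0.

(* The piecewise linear function with divisor X - Y has value phi at the vertices;
   k is the slope at the source of an edge, before any point of X or Y represented
   on it: passing a point of X (of Y) lowers (raises) the slope by 1, so that these
   points count at the target of the edge in the balancing condition. The balancing
   condition at all vertices is stated in weak form; with test functions constant
   on the edges of length zero, it is the condition on their contraction. *)
Definition certificate (X Y : seq rep) (phi : vertex G -> R)
    (k : edge G -> int) : Prop :=
  (forall e, phi (tgt e) - phi (src e) = (k e)%:~R * l e - net X Y (rest e)) /\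
  (forall psi : vertex G -> int, (forall e, l e = 0 -> psi (src e) = psi (tgt e)) ->
    \sum_e k e * (psi (tgt e) - psi (src e)) = net X Y (head_value psi)).

Definition certified X Y := exists phi k, certificate X Y phi k.

End Certificate.

Section Net.
Variables (R : realType) (G : graph).
Implicit Types (X Y : seq (rep R G)).

Lemma netB (V : zmodType) X Y (h h' : rep R G -> V) :
  net X Y (fun z => h z - h' z) = net X Y h - net X Y h'.
Proof. by rewrite /net !sumrB !opprD addrACA. Qed.

Lemma netM (V : ringType) X Y c (h : rep R G -> V) :
  net X Y (fun z => c * h z) = c * net X Y h.
Proof. by rewrite /net -!mulr_sumr mulrBr. Qed.

Lemma net_sum (V : zmodType) (I : finType) X Y (h : I -> rep R G -> V) :
  net X Y (fun z => \sum_i h i z) = \sum_i net X Y (h i).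
Proof.
by rewrite /net exchange_big /= [X in _ - X]exchange_big /= -sumrB.
Qed.

Lemma eq_net (V : zmodType) X Y (P : pred (rep R G)) (h h' : rep R G -> V) :
  all P X -> all P Y -> (forall z, P z -> h z = h' z) -> net X Y h = net X Y h'.
Proof.
move=> /allP XP /allP YP hh'; congr (_ - _);
  rewrite big_seq [RHS]big_seq; apply: eq_bigr => z.
  by move=> /XP/hh'.
by move=> /YP/hh'.
Qed.

Lemma near_net (F : set_system R) {FF : Filter F} X Y
    (A : R -> rep R G -> R) (B : rep R G -> R) (c : rep R G -> int) :
  (forall z, \forall h \near F, A h z = B z + (c z)%:~R * h) ->
  \forall h \near F, net X Y (A h) = net X Y B + (net X Y c)%:~R * h.
Proof.
move=> ABc.
have near_sum Z : \forall h \near F, \sum_(z <- Z) A h z =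
    \sum_(z <- Z) B z + (\sum_(z <- Z) c z)%:~R * h.
  elim: Z => [|z Z IH]; first by near=> h; rewrite !big_nil mul0r addr0.
  near=> h; rewrite !big_cons (near IH h) // (near (ABc z) h) // intrD; ring.
near=> h; rewrite /net (near (near_sum X) h) // (near (near_sum Y) h) // intrB; ring.
Unshelve. all: by end_near.
Qed.

End Net.

Section Profile.
Variables (R : realType) (G : graph).
Implicit Types (X Y : seq (rep R G)) (z : rep R G) (e : edge G).

(** A point at [s] bends the function by a ramp of slope 1 starting at [s]. [count_le] and
    [count_lt] are the right and left derivatives of the ramp; they differ exactly when [s = t],
    which is how the point enters the divisor. *)
Definition ramp e (t : R) z : R :=
  if z is inr (e', s) then if e' == e then Num.max 0 (t - s) else 0 else 0.
Definition count_le e (t : R) z : int :=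
  if z is inr (e', s) then ((e' == e) && (s <= t))%:Z else 0.
Definition count_lt e (t : R) z : int :=
  if z is inr (e', s) then ((e' == e) && (s < t))%:Z else 0.

Lemma ramp_right e t z : \forall h \near 0^'+,
  ramp e (t + h) z = ramp e t z + (count_le e t z)%:~R * h.
Proof.
apply/near_at_right0P; case: z => [v|[e' s]] /=.
  by exists 1 => // h _; rewrite mul0r addr0.
case: eqP => _ /=; last by exists 1 => // h _; rewrite mul0r addr0.
have [st|ts] := leP s t.
  exists 1 => // h h0; rewrite mul1r.
  by do 2 (case: lerP => ?); lra.
exists (s - t) => [|h h0]; first lra.
by rewrite mul0r; do 2 (case: lerP => ?); lra.
Qed.

Lemma ramp_left e t z : \forall h \near 0^'+,
  ramp e (t - h) z = ramp e t z + (- count_lt e t z)%:~R * h.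
Proof.
apply/near_at_right0P; case: z => [v|[e' s]] /=.
  by exists 1 => // h _; rewrite mul0r addr0.
case: eqP => _ /=; last by exists 1 => // h _; rewrite mul0r addr0.
have [st|ts] := ltP s t.
  exists (t - s) => [|h h0]; first lra.
  by rewrite mulN1r; do 2 (case: lerP => ?); lra.
exists 1 => // h h0.
by rewrite oppr0 mul0r; do 2 (case: lerP => ?); lra.
Qed.

Variables (X Y : seq (rep R G)) (c : edge G -> R) (k : edge G -> int).

Definition profile e t : R := c e + (k e)%:~R * t - net X Y (ramp e t).

Lemma profile_right e t : \forall h \near 0^'+,
  profile e (t + h) = profile e t + (k e - net X Y (count_le e t))%:~R * h.
Proof.
have near_r : \forall h \near 0^'+, net X Y (ramp e (t + h)) =
    net X Y (ramp e t) + (net X Y (count_le e t))%:~R * h.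
  by apply: near_net => z; exact: ramp_right.
by near=> h; rewrite /profile (near near_r h) // [(k e - _)%:~R]intrB; ring.
Unshelve. all: by end_near.
Qed.

Lemma profile_left e t : \forall h \near 0^'+,
  profile e (t - h) = profile e t - (k e - net X Y (count_lt e t))%:~R * h.
Proof.
have near_l : \forall h \near 0^'+, net X Y (ramp e (t - h)) =
    net X Y (ramp e t) + (net X Y (fun z => - count_lt e t z))%:~R * h.
  by apply: near_net => z; exact: ramp_left.
have netN : net X Y (fun z => - count_lt e t z) = - net X Y (count_lt e t).
  by rewrite /net !sumrN opprB opprK addrC.
by near=> h; rewrite /profile (near near_l h) // netN [(k e - _)%:~R]intrB mulrNz; ring.
Unshelve. all: by end_near.
Qed.

End Profile.

(** * Certificates and piecewise linear functions on a metric graph *)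

Section CertificatePrincipal.
Variables (R : realType) (Gam : metric_graph R).
Implicit Types (z : rep R Gam) (X Y : seq (rep R Gam)) (e : edge Gam)
  (a : edge Gam * bool) (f : point Gam -> R).

Definition rep_point z : point Gam :=
  match z with inl v => vpt v | inr (e, t) => ept e t end.

Definition indicator (v u : vertex Gam) : int := (u == v)%:Z.

Local Notation valid := (rep_valid (@len R Gam)).

Lemma net_count X Y x : net X Y (fun z => (rep_point z == x)%:Z) =
  (count_mem x (map rep_point X))%:Z - (count_mem x (map rep_point Y))%:Z.
Proof.
have sum_count Z : \sum_(z <- Z) (rep_point z == x)%:Z =
    (count_mem x (map rep_point Z))%:Z.
  elim: Z => [|z Z IH]; first by rewrite big_nil.
  by rewrite big_cons IH /= PoszD.
by rewrite /net !sum_count.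
Qed.

Lemma rep_point_inner e t z : valid z -> 0 < t < len e ->
  count_le e t z - count_lt e t z = (rep_point z == ept e t)%:Z.
Proof.
case: z => [v|[e' s]] /= zv et.
  by case: eqP => // /esym/(ept_neq_vpt et).
have [ee'|ne] := eqVneq e' e; last first.
  case: eqP => // E; have [s0|sn0] := eqVneq s 0.
    by move: E; rewrite s0 ept0 => /esym/(ept_neq_vpt et).
  have [sl|snl] := eqVneq s (len e').
    by move: E; rewrite sl ept_len => /esym/(ept_neq_vpt et).
  have es : 0 < s < len e' by rewrite !lt_neqAle eq_sym sn0 snl; lra.
  by have [E' _] := ept_inj es et E; rewrite E' eqxx in ne.
subst e' => /=; have [->|st] := eqVneq s t; first by rewrite lexx ltxx eqxx.
rewrite lt_neqAle st /= subrr; case: eqP => // E.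
have [s0|sn0] := eqVneq s 0.
  by move: E; rewrite s0 ept0 => /esym/(ept_neq_vpt et).
have [sl|snl] := eqVneq s (len e).
  by move: E; rewrite sl ept_len => /esym/(ept_neq_vpt et).
have es : 0 < s < len e by rewrite !lt_neqAle eq_sym sn0 snl; lra.
by have [_ E'] := ept_inj es et E; rewrite E' eqxx in st.
Qed.

(** Corrects the convention that every point of an edge counts at its target: one at parameter 0
    lies at the source, and one before the end does not lie at the target. The correction terms are
    those by which the slopes at the two ends of an edge differ from [k]. *)
Lemma rep_point_vertex v z : valid z ->
  (rep_point z == vpt v)%:Z - head_value (indicator v) z =
  \sum_e ((src e == v)%:Z * count_le e 0 z - (tgt e == v)%:Z * count_lt e (len e) z).
Proof.
case: z => [u _|[e s] /= zv].
  rewrite big1 /= => [|e _]; last by rewrite !mulr0 subrr.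
  by rewrite (inj_eq (@vpt_inj _ _)) subrr.
rewrite (bigD1 e) //= eqxx big1 ?addr0 /= => [|e' ee']; last first.
  by rewrite [e == e']eq_sym (negbTE ee') !mulr0 subrr.
rewrite /indicator; have [s0|sn0] := eqVneq s 0.
  rewrite s0 ept0 lexx len_gt0 !mulr1 (inj_eq (@vpt_inj _ _)) //.
have [sl|snl] := eqVneq s (len e).
  rewrite sl ept_len ltxx leNgt len_gt0 !mulr0 (inj_eq (@vpt_inj _ _)).
  by rewrite subrr subr0.
have es : 0 < s < len e by rewrite !lt_neqAle eq_sym sn0 snl; lra.
have -> : s <= 0 = false by apply/negbTE; rewrite -ltNge; lra.
have -> : s < len e by lra.
by case: eqP => [/(ept_neq_vpt es)//|_]; rewrite mulr0 mulr1 !add0r.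
Qed.

Section Slopes.
Variables (X Y : seq (rep R Gam)) (phi : vertex Gam -> R) (k : edge Gam -> int).
Hypotheses (Xv : all valid X) (Yv : all valid Y).
Local Notation prof := (profile X Y (fun e => phi (src e)) k).
Variable f : point Gam -> R.
Hypothesis fE : forall e t, 0 <= t <= len e -> f (ept e t) = prof e t.

Definition profile_slope a (t : R) : int :=
  if a.2 then net X Y (count_le a.1 t) - k a.1
  else k a.1 - net X Y (count_lt a.1 (len a.1 - t)).

Lemma profile_slopeP a t : 0 <= t < len a.1 -> slope_at f a t (profile_slope a t).
Proof.
move=> tL; apply/slope_atP.
have small : \forall h \near 0^'+, 0 < h <= len a.1 - t.
  by apply/near_at_right0P; exists (len a.1 - t) => //; lra.
case: a tL small => e [] /= tL small.
- have pr := profile_right X Y (fun e => phi (src e)) k e t.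
  near=> h; have hL : 0 < h <= len e - t by near: h.
  rewrite !dpt_true !fE; [|lra|lra].
  by rewrite (near pr h) // /profile_slope /= -opprB mulrNz; ring.
- have pl := profile_left X Y (fun e => phi (src e)) k e (len e - t).
  near=> h; have hL : 0 < h <= len e - t by near: h.
  rewrite !dpt_false !fE; [|lra|lra].
  rewrite (_ : len e - (t + h) = len e - t - h); last ring.
  by rewrite (near pl h) // /profile_slope /=; ring.
Unshelve. all: by end_near.
Qed.

Lemma ord_profile_inner e t : 0 < t < len e -> ord f (ept e t) =
  (count_mem (ept e t) (map rep_point X))%:Z - (count_mem (ept e t) (map rep_point Y))%:Z.
Proof.
move=> et; rewrite (ord_ept profile_slopeP et) /profile_slope /=.
rewrite (_ : len e - (len e - t) = t); last ring.
rewrite addrA subrK -netB -net_count; apply: (eq_net Xv Yv) => z zv.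
exact: rep_point_inner.
Qed.

(** Equates the error in the divisor at [v] with the error in the balancing condition at [v], so
    that it serves both directions of [certified_lin_eq]. *)
Lemma ord_profile_vertex v : ord f (vpt v) - 
    ((count_mem (vpt v) (map rep_point X))%:Z - (count_mem (vpt v) (map rep_point Y))%:Z) =
  \sum_e k e * (indicator v (tgt e) - indicator v (src e))
  - net X Y (head_value (indicator v)).
Proof.
have key : net X Y (fun z => (rep_point z == vpt v)%:Z) -
      net X Y (head_value (indicator v)) =
    \sum_e ((src e == v)%:Z * net X Y (count_le e 0) -
             (tgt e == v)%:Z * net X Y (count_lt e (len e))).
  rewrite -netB (eq_net Xv Yv (fun z => @rep_point_vertex v z)) net_sum.
  by apply: eq_bigr => e _; rewrite netB !netM.
rewrite -net_count; apply/eqP; rewrite subr_eq -addrA [- _ + _]addrC key.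
apply/eqP.
rewrite (ord_vpt profile_slopeP) -big_split /= big_mkcond /=.
rewrite (eq_bigr (fun p : edge Gam * bool => (fun e b => if dart_src (e, b) == v
   then profile_slope (e, b) 0 else 0) p.1 p.2)); last by case.
rewrite -(pair_bigA _ (fun e b => if dart_src (e, b) == v
   then profile_slope (e, b) 0 else 0)) /=.
apply: eq_bigr => e _; rewrite big_bool /= /dart_src /profile_slope /= subr0.
rewrite /indicator.
by do 2 case: eqP => _ /=; ring.
Qed.

End Slopes.

Lemma indicator_condition X Y (k : edge Gam -> int) :
  (forall v, \sum_e k e * (indicator v (tgt e) - indicator v (src e)) =
             net X Y (head_value (indicator v))) ->
  forall psi, \sum_e k e * (psi (tgt e) - psi (src e)) = net X Y (head_value psi).
Proof.
move=> indk psi.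
have psiE u : psi u = \sum_v psi v * indicator v u.
  rewrite (bigD1 u) //= /indicator eqxx mulr1 big1 ?addr0 // => v vu.
  by rewrite eq_sym (negbTE vu) mulr0.
have headE z : predT z -> head_value psi z = \sum_v psi v * head_value (indicator v) z.
  by move=> _; case: z => [v|[e t]] /=; exact: psiE.
rewrite (eq_net (all_predT X) (all_predT Y) headE) net_sum.
rewrite (eq_bigr (fun v => \sum_e psi v * (k e * (indicator v (tgt e) -
  indicator v (src e))))); last by move=> v _; rewrite netM -indk mulr_sumr.
rewrite exchange_big /=; apply: eq_bigr => e _.
rewrite {1}(psiE (tgt e)) {1}(psiE (src e)) -sumrB mulr_sumr.
by apply: eq_bigr => v _; ring.
Qed.

Lemma net_ramp0 X Y e : all valid X -> all valid Y -> net X Y (ramp e 0) = 0.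
Proof.
move=> Xv Yv; rewrite (eq_net (h' := fun=> 0) Xv Yv).
  by rewrite /net !big1 // subrr.
by case=> [//|[e' s]] /= se; case: eqP => // ee'; apply/max_idPl; lra.
Qed.

Lemma net_ramp_len X Y e : all valid X -> all valid Y ->
  net X Y (ramp e (len e)) = net X Y (rest (@len R Gam) e).
Proof.
move=> Xv Yv; apply: (eq_net Xv Yv).
by case=> [//|[e' s]] /= se; case: eqP => // ee'; subst e'; apply/max_idPr; lra.
Qed.

(** A certificate gives a profile on each edge, and the edge equations glue the profiles at the
    targets. Conversely, the initial slope of [f] on an edge and the jumps prescribed by its divisor
    determine [f] there, so that it is a profile. *)
Lemma certified_lin_eq X Y : all valid X -> all valid Y ->
  certified (@len R Gam) X Y <-> lin_eq (map rep_point X) (map rep_point Y).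
Proof.
move=> Xv Yv; split.
  move=> [phi [k [edge_eq vertex_eq]]].
  pose prof := profile X Y (fun e => phi (src e)) k.
  pose f x := match point_val x with inl v => phi v | inr (e, t) => prof e t end.
  have fE e t : 0 <= t <= len e -> f (ept e t) = prof e t.
    move=> te; have [->|tn0] := eqVneq t 0.
      by rewrite /prof /profile net_ramp0 // ept0 mulr0 addr0 subr0.
    have [->|tnl] := eqVneq t (len e).
      rewrite /prof /profile net_ramp_len // ept_len -addrA -edge_eq /f /=.
      by rewrite addrC subrK.
    by rewrite /f ept_inner // !lt_neqAle eq_sym tn0 tnl; lra.
  exists f.
    apply: loc_pl_int_pl => a t tL; exists (profile_slope X Y k a t).
    exact: profile_slopeP fE _ _ tL.
  move=> x; case: (pointP x) => [v|e t et].
    apply/eqP; rewrite -subr_eq0 (ord_profile_vertex Xv Yv fE) vertex_eq ?subrr //.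
    by move=> e /eqP; rewrite gt_eqF ?len_gt0.
  exact: (ord_profile_inner Xv Yv fE).
move=> [f fpl ordf]; have floc := int_pl_loc_pl fpl.
have [S SP] : exists S : edge Gam * bool -> R -> int,
    forall a t, 0 <= t < len a.1 -> slope_at f a t (S a t).
  have /choice[S SP] : forall p : edge Gam * bool * R, exists k,
      0 <= p.2 < len p.1.1 -> slope_at f p.1 p.2 k.
    move=> [a t] /=; have [tL|tL] := boolP (0 <= t < len a.1); last by exists 0.
    by have [k fk] := floc a t tL; exists k.
  by exists (fun a t => S (a, t)) => a t; exact: (SP (a, t)).
pose phi v := f (vpt v).
(* [- S (e, true) 0] is the slope of [f] just after the source. Points represented at parameter 0
   have already bent the profile there, and [k] is the slope before them. *)
pose k e := net X Y (count_le e 0) - S (e, true) 0.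
pose prof := profile X Y (fun e => phi (src e)) k.
have fE e : forall t, 0 <= t <= len e -> f (ept e t) = prof e t.
  apply: real_induction.
  - by rewrite ept0 /prof /profile net_ramp0 // mulr0 addr0 subr0.
  - move=> t te eqt.
    (* To the left of [t] the slope is that of the profile by induction; the divisor at [ept e t]
       fixes the jump, hence the slope to the right. *)
    have SE : S (e, true) t = net X Y (count_le e t) - k e.
      have [->|tn0] := eqVneq t 0; first by rewrite /k subKr.
      have te' : 0 < t < len e by rewrite lt_neqAle eq_sym tn0; lra.
      have SL : S (e, false) (len e - t) = k e - net X Y (count_lt e t).
        apply: (slope_at_uniq (SP (e, false) (len e - t) ltac:(rewrite /=; lra))).
        apply/slope_atP; have small : \forall h \near 0^'+, 0 < h <= t.
          by apply/near_at_right0P; exists t => //; lra.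
        have pl := profile_left X Y (fun e => phi (src e)) k e t.
        near=> h; have ht : 0 < h <= t by near: h.
        rewrite !dpt_false (_ : len e - (len e - t) = t); last ring.
        rewrite (_ : len e - (len e - t + h) = t - h); last ring.
        by rewrite !eqt; [rewrite /prof (near pl h) //; ring|lra|lra].
      have := ordf (ept e t); rewrite (ord_ept SP te') SL -net_count.
      have rep_point_t z := fun zv => @rep_point_inner e t z zv te'.
      by rewrite -(eq_net Xv Yv rep_point_t) netB; lia.
    have [d d0 fd] := SP (e, true) t te.
    have /near_at_right0P[d' d'0 pd] := profile_right X Y (fun e => phi (src e)) k e t.
    exists (Num.min d d') => [|h]; first by rewrite lt_min d0.
    rewrite le_min => /andP[h0 /andP[hd hd']] _.
    rewrite /prof pd ?h0 // -/(prof e t) -eqt; last lra.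
    have := fd h; rewrite (ltW h0) hd !dpt_true SE => /(_ isT) ->.
    by rewrite -opprB mulrNz; ring.
  - move=> t te eqt.
    have [|d d0 fd] := SP (e, false) (len e - t); first by rewrite /=; lra.
    have /near_at_right0P[d' d'0 pd] := profile_left X Y (fun e => phi (src e)) k e t.
    pose h := Num.min t (Num.min d d').
    have h0 : 0 < h by rewrite !lt_min d0 d'0; lra.
    have [ht hd hd'] : [/\ h <= t, h <= d & h <= d'].
      by split; rewrite !ge_min lexx ?orbT.
    (* The difference at [t] equals a fixed multiple of [u] for all small [u > 0]; comparing [u = h]
       with [u = h / 2] shows that it vanishes. *)
    have diff u : 0 < u <= h -> f (ept e t) - prof e t =
        (S (e, false) (len e - t) - (k e - net X Y (count_lt e t)))%:~R * u.
      move=> uh; have := fd u ltac:(lra); have := pd u ltac:(lra).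
      rewrite !dpt_false (_ : len e - (len e - t) = t); last ring.
      rewrite (_ : len e - (len e - t + u) = t - u); last ring.
      rewrite (eqt (t - u)); last lra.
      by rewrite /prof => -> ->; rewrite [(S _ _ - _)%:~R]intrB; ring.
    have hh : 0 < h <= h by rewrite h0 lexx.
    have hh2 : 0 < h / 2 <= h by clearbody h; lra.
    by have := diff h hh; have := diff _ hh2; lra.
exists phi, k; split.
  move=> e; have := fE e (len e); rewrite ltW ?len_gt0 // lexx => /(_ isT).
  rewrite ept_len /prof /profile net_ramp_len // -/(phi (tgt e)) => ->; ring.
move=> psi _; apply: indicator_condition => v.
apply/eqP; rewrite -subr_eq0 -(ord_profile_vertex Xv Yv fE) ordf.
by rewrite subrr.
Unshelve. all: by end_near.
Qed.

Lemma point_valK (x : point Gam) : rep_point (point_val x) = x.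
Proof. by case: (pointP x) => [//|e t et]; rewrite ept_inner. Qed.

Lemma point_val_valid (x : point Gam) : valid (point_val x).
Proof. by case: (pointP x) => [//|e t et]; rewrite ept_inner //=; lra. Qed.

(** Principal divisors have degree 0: test the balancing condition against the constant 1. *)
Lemma lin_eq_size (X Y : seq (point Gam)) : lin_eq X Y -> size X = size Y.
Proof.
have mapK Z : map rep_point (map (@point_val R Gam) Z) = Z.
  by rewrite -map_comp map_id_in // => x _; exact: point_valK.
have map_valid Z : all valid (map (@point_val R Gam) Z).
  by apply/allP => _ /mapP[x _ ->]; exact: point_val_valid.
rewrite -{1}[X]mapK -{1}[Y]mapK => /certified_lin_eq[//|//|phi [k [_]]].
move=> /(_ (fun=> 1) (fun _ _ => erefl)).
rewrite big1 => [|e _]; last by rewrite subrr mulr0.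
have net1 Z : \sum_(z <- map (@point_val R Gam) Z) head_value (fun=> 1) z = (size Z)%:Z.
  elim: Z => [|z Z IH]; first by rewrite big_nil.
  by rewrite /= big_cons IH; case: (point_val z) => [|[]] *; rewrite -PoszD.
by rewrite /net !net1; lia.
Qed.

End CertificatePrincipal.

(** * Ranks in terms of lists of points *)

(** The bounds [lo] and [hi] ensure that a maximum exists, so that the default value 0 of [xget] is
    never mistaken for one. *)
Lemma largest_geP (A : set int) (lo hi m : int) :
  (forall i j, i <= j -> A j -> A i) -> A lo -> ubound A hi ->
  m <= largest A <-> A m.
Proof.
move=> Adown Alo Ahi.
have [k kA] : exists k, (A `&` ubound A) k.
  pose P (n : nat) : bool := `[< A (lo + n%:Z) >].
  have exP : exists n, P n by exists 0%N; apply/asboolP; rewrite addr0.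
  have Pbd n : P n -> (n <= `|hi - lo|)%N.
    by move=> /asboolP /Ahi; lia.
  case: (ex_maxnP exP Pbd) => n /asboolP An nmax.
  exists (lo + n%:Z); split => // j Aj.
  have [jlo|jlo] := leP j lo; first lia.
  have /nmax : P `|j - lo|%N.
    by apply/asboolP; have -> : lo + `|j - lo|%N%:Z = j by lia.
  lia.
have [Al ubl] : (A `&` ubound A) (largest A) by exact: xgetI kA.
by split=> [/Adown/(_ Al)|/ubl].
Qed.

Section Lists.
Variables (R : realType) (Gam : metric_graph R).
Implicit Types (X Y : seq (point Gam)) (D E : divisor Gam).

Definition divisor_of X : divisor Gam := \sum_(x <- X) << x >>.

Lemma divisor_of_cat X Y : divisor_of (X ++ Y) = divisor_of X + divisor_of Y.
Proof. exact: big_cat. Qed.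

Lemma coeff_divisor_of x X : coeff x (divisor_of X) = (count_mem x X)%:Z.
Proof.
elim: X => [|y X IH]; first by rewrite /divisor_of big_nil coeff0.
by rewrite /divisor_of big_cons coeffD IH coeffU /= mul1r PoszD; congr (_ + _); case: eqP.
Qed.

Lemma deg_divisor_of X : deg (divisor_of X) = (size X)%:Z.
Proof.
elim: X => [|y X IH]; first by rewrite /divisor_of big_nil deg0.
by rewrite /divisor_of big_cons degD IH degU /= -add1n PoszD.
Qed.

Lemma effective_divisor_of X : effective (divisor_of X).
Proof. by apply/fgposP => x; rewrite coeff_divisor_of. Qed.

Lemma effectiveP D : effective D -> exists X, D = divisor_of X.
Proof.
move=> /fgposP D_ge0.
exists (flatten [seq nseq `|coeff x D|%N x | x <- dom D]).
rewrite -[LHS]freeg_sumE /divisor_of big_flatten [RHS]big_map; apply: eq_bigr => x _.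
rewrite big_nseq iter_addr_0 freegU_muln; congr << _ *g _ >>.
by rewrite natz gez0_abs.
Qed.

Lemma equivalent_divisor_of X Y : equivalent (divisor_of X) (divisor_of Y) <-> lin_eq X Y.
Proof.
by split=> -[f fpl fE]; exists f => // x;
  move: (fE x); rewrite coeffB !coeff_divisor_of.
Qed.

(** Pad [E] with copies of a vertex up to degree [j]; what contains the padded divisor contains
    [E]. *)
Lemma effective_sub_down (i j : int) (P : divisor Gam -> Prop) : i <= j ->
  (forall E, effective E -> deg E = j -> exists2 D, P D & effective (D - E)) ->
  forall E, effective E -> deg E = i -> exists2 D, P D & effective (D - E).
Proof.
move=> ij Pj _ /effectiveP[X ->]; rewrite deg_divisor_of => Xi.
have [/card_gt0P[v _] _] := mgraph_connected Gam.
pose Y := nseq `|j - i|%N (vpt v).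
have [] := Pj (divisor_of (X ++ Y)) (effective_divisor_of _).
  by rewrite deg_divisor_of size_cat size_nseq PoszD Xi; lia.
move=> D PD effD; exists D => //.
apply/fgposP => x; move/fgposP/(_ x): effD.
by rewrite divisor_of_cat !coeffB !coeffD !coeff_divisor_of; lia.
Qed.

Lemma no_effective_neg E (i : int) : effective E -> deg E = i -> 0 <= i.
Proof. by move=> /effectiveP[X ->] <-; rewrite deg_divisor_of. Qed.

Lemma effective_subP D Y : effective (D - divisor_of Y) ->
  exists Z, D = divisor_of (Y ++ Z).
Proof.
by case/effectiveP => Z eqD; exists Z; rewrite divisor_of_cat -eqD addrC subrK.
Qed.

(** In [largest_geP], the lower bound [-1] holds vacuously, as no effective divisor has negative
    degree, and [size X] is an upper bound because equivalent divisors have the same degree. *)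
Lemma rank_geP X (r : nat) : r%:Z <= rank (divisor_of X) <->
  forall Y, size Y = r -> exists Z, lin_eq (Y ++ Z) X.
Proof.
have listP : (forall E, effective E -> deg E = r ->
    exists2 D', equivalent D' (divisor_of X) & effective (D' - E)) <->
  forall Y, size Y = r -> exists Z, lin_eq (Y ++ Z) X.
  split=> [rk Y Yr|rk _ /effectiveP[Y ->]]; last first.
    rewrite deg_divisor_of => -[/rk[Z /equivalent_divisor_of YZ]].
    exists (divisor_of (Y ++ Z)) => //.
    by rewrite divisor_of_cat addrC addKr; exact: effective_divisor_of.
  have [|D' D'X /effective_subP[Z D'E]] := rk (divisor_of Y) (effective_divisor_of Y).
    by rewrite deg_divisor_of Yr.
  by exists Z; apply/equivalent_divisor_of; rewrite -D'E.
rewrite -listP /rank.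
have lgP := @largest_geP [set r | forall E, effective E -> deg E = r ->
  exists2 D', equivalent D' (divisor_of X) & effective (D' - E)] (-1) (size X) r.
case: asboolP => [effX|neffX]; last first.
  split=> [//|/listP rk]; case: neffX.
  have [/card_gt0P[v _] _] := mgraph_connected Gam.
  have [|Z /equivalent_divisor_of XZ] := rk (nseq r (vpt v)); first by rewrite size_nseq.
  by exists (divisor_of (nseq r (vpt v) ++ Z)) => //; exact: effective_divisor_of.
apply: lgP.
- by move=> i j ij; apply: effective_sub_down.
- by move=> E /no_effective_neg/[apply].
- move=> j Aj; have [|j0] := leP j 0; first lia.
  have [/card_gt0P[v _] _] := mgraph_connected Gam.
  have [||D' D'X /effective_subP[Z D'E]] := Aj (divisor_of (nseq `|j|%N (vpt v))).
  + exact: effective_divisor_of.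
  + by rewrite deg_divisor_of size_nseq; lia.
  move: D'X; rewrite D'E => /equivalent_divisor_of/lin_eq_size.
  by rewrite size_cat size_nseq; lia.
Qed.

Definition bn_property (r d n : nat) : Prop :=
  forall X, size X = (r + n)%N -> exists2 X', size (X ++ X') = d &
    forall Y, size Y = r -> exists Y', lin_eq (Y ++ Y') (X ++ X').

Lemma bn_rank_geP (r d n : nat) : n%:Z <= bn_rank Gam r d <-> bn_property r d n.
Proof.
pose B := [set rho | forall E : divisor Gam, effective E -> deg E = r%:Z + rho ->
      exists D, [/\ deg D = d%:Z, r%:Z <= rank D & effective (D - E)]].
have listP : B n%:Z <-> bn_property r d n.
  split=> [Bn X Xn|Bn _ /effectiveP[X ->]].
    have [|D [degD rkD /effective_subP[X' DE]]] :=
      Bn (divisor_of X) (effective_divisor_of X).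
      by rewrite deg_divisor_of Xn PoszD.
    exists X'; first by move: degD; rewrite DE deg_divisor_of => -[].
    by apply/rank_geP; rewrite -DE.
  rewrite deg_divisor_of -PoszD => -[/Bn[X' XX' rk]]; exists (divisor_of (X ++ X')); split.
  - by rewrite deg_divisor_of XX'.
  - exact/rank_geP.
  - by rewrite divisor_of_cat addrC addKr; exact: effective_divisor_of.
rewrite -listP /bn_rank.
case: asboolP => [_|nW]; last first.
  split=> [//|/listP Bn]; case: nW.
  have [/card_gt0P[v _] _] := mgraph_connected Gam.
  have [|X' XX' rk] := Bn (nseq (r + n) (vpt v)); first by rewrite size_nseq.
  exists (divisor_class (divisor_of (nseq (r + n) (vpt v) ++ X'))).
  exists (divisor_of (nseq (r + n) (vpt v) ++ X')) => //=.
  by split; [rewrite deg_divisor_of XX'|apply/rank_geP].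
(* At [rho = - r - 1] the divisors [E] would have degree -1, so the condition is vacuous; at the
   other end, [E] is contained in a divisor of degree [d]. *)
apply: (@largest_geP _ (- r%:Z - 1) d%:Z).
- move=> i j ij Bj E effE degE.
  have [|E' effE' degE'|D [degD rkD] DE] := @effective_sub_down (r%:Z + i) (r%:Z + j)
    (fun D => deg D = d%:Z /\ r%:Z <= rank D) _ _ E effE degE.
  + by rewrite lerD2l.
  + by have [D [? ? ?]] := Bj _ effE' degE'; exists D.
  + by exists D.
- by move=> E /no_effective_neg/[apply]; lia.
- move=> j Bj; have [rj|rj] := leP (r%:Z + j) 0; first lia.
  have [/card_gt0P[v _] _] := mgraph_connected Gam.
  have [||D [degD _ /effective_subP[Z DE]]] :=
    Bj (divisor_of (nseq (absz (r%:Z + j)) (vpt v))).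
  + exact: effective_divisor_of.
  + by rewrite deg_divisor_of size_nseq; lia.
  by move: degD; rewrite DE deg_divisor_of size_cat size_nseq; lia.
Qed.

End Lists.

(** * Equivalence of arbitrary divisors, and the lower bound -1 *)

Section PrincipalDifference.
Variables (R : realType) (Gam : metric_graph R).
Implicit Types (D : divisor Gam) (f g : point Gam -> R).

Lemma slope_atB f g a t k m : slope_at f a t k -> slope_at g a t m ->
  slope_at (fun x => f x - g x) a t (k - m).
Proof.
move=> /slope_atP fk /slope_atP gm; apply/slope_atP; near=> h.
rewrite (near fk h) // (near gm h) // intrB; ring.
Unshelve. all: by end_near.
Qed.

Lemma ordB f g x : loc_pl f -> loc_pl g ->
  ord (fun x => f x - g x) x = ord f x - ord g x.
Proof.
move=> fl gl; rewrite /ord -sumrB; apply: eq_bigr => a _.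
have [[t at_]|noarm] := pselect (exists t, arm x a t); last first.
  by rewrite !(@xget_no_slope _ _ _ x) ?subrr // => t at_; case: noarm; exists t.
have [[k fk] [m gm]] := (fl a t at_.1, gl a t at_.1).
by rewrite (xget_slope at_ fk) (xget_slope at_ gm) (xget_slope at_ (slope_atB fk gm)).
Qed.

Lemma equivalent_common D D1 D2 : equivalent D1 D -> equivalent D2 D -> equivalent D1 D2.
Proof.
move=> [f /int_pl_loc_pl fl fE] [g /int_pl_loc_pl gl gE].
exists (fun x => f x - g x) => [|x].
  apply: loc_pl_int_pl => a t tL; have [[k fk] [m gm]] := (fl a t tL, gl a t tL).
  by exists (k - m); exact: slope_atB.
rewrite ordB // -fE -gE -coeffB; congr (coeff x _).
by rewrite opprB addrA subrK.
Qed.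

(** Moving the negative parts to the other side leaves sums of points, where [lin_eq_size]
    applies. *)
Lemma equivalent_deg D D' : equivalent D D' -> deg D = deg D'.
Proof.
have divisor_ofE D0 : exists X Y, D0 = divisor_of X - divisor_of Y.
  have /effectiveP[X XE] := fgpos_le0 D0; have /effectiveP[Y YE] := fgneg_le0 D0.
  by exists X, Y; rewrite -XE -YE; exact: fg_decomp.
have [[X [Y ->]] [X' [Y' ->]]] := (divisor_ofE D, divisor_ofE D').
rewrite /equivalent (_ : divisor_of X - divisor_of Y - (divisor_of X' - divisor_of Y')
  = divisor_of (X ++ Y') - divisor_of (X' ++ Y)).
  move=> /equivalent_divisor_of/lin_eq_size; rewrite !size_cat !degB !deg_divisor_of; lia.
rewrite !divisor_of_cat opprB opprD addrACA; congr (_ + _); exact: addrC.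
Qed.

(** If [D] has rank at least [r], every effective [E] of degree [r] is contained in some [D']
    equivalent to [D], and [D'] inherits the rank condition. So [rho = 0] is attained whenever the
    locus is nonempty. *)
Lemma bn_rank_geN1 (r d : nat) : -1 <= bn_rank Gam r d.
Proof.
have [W|nW] := pselect (@bn_locus R Gam r d !=set0); last first.
  by rewrite /bn_rank; case: asboolP.
suff : 0%:Z <= bn_rank Gam r d by lia.
apply/bn_rank_geP; have [_ [D [degD rD] _]] := W.
have {rD} rD E : effective E -> deg E = r ->
    exists2 D', equivalent D' D & effective (D' - E).
  move: rD E; rewrite /rank; case: asboolP => [[D0 D0D /effectiveP[X0 X0E]]|_]; last lia.
  apply: (largest_geP _ (lo := -1) (hi := (size X0)%:Z) _ _ _).1.
  - by move=> i j ij; exact: effective_sub_down.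
  - by move=> E /no_effective_neg/[apply].
  - move=> j Aj; have [|j0] := leP j 0; first lia.
    have [/card_gt0P[v _] _] := mgraph_connected Gam.
    have [||D' D'D /effective_subP[Z D'E]] := Aj (divisor_of (nseq `|j|%N (vpt v))).
    + exact: effective_divisor_of.
    + by rewrite deg_divisor_of size_nseq; lia.
    have := equivalent_common D'D D0D.
    rewrite D'E X0E => /equivalent_divisor_of/lin_eq_size.
    by rewrite size_cat size_nseq; lia.
move=> X; rewrite addn0 => Xr.
have [|D' D'D /effective_subP[X' D'E]] := rD (divisor_of X) (effective_divisor_of X).
  by rewrite deg_divisor_of Xr.
exists X' => [|Y Yr].
  by have := equivalent_deg D'D; rewrite degD D'E deg_divisor_of => -[].
have [|D2 D2D /effective_subP[Y' D2E]] := rD (divisor_of Y) (effective_divisor_of Y).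
  by rewrite deg_divisor_of Yr.
exists Y'; apply/equivalent_divisor_of; rewrite -D2E -D'E.
exact: equivalent_common D2D D'D.
Qed.

End PrincipalDifference.

(** * Invariance under isometries *)

Section Metric.
Variables (R : realType) (Gam : metric_graph R).
Implicit Types (a b : edge Gam * bool) (e : edge Gam) (t h d : R)
  (x y z : point Gam) (F : point Gam -> R).

Lemma chain_length_ge0 (c : seq (edge Gam * (R * R))) : 0 <= chain_length c.
Proof. by apply: sumr_ge0. Qed.

Lemma chain_length_cons (s : edge Gam * (R * R)) c :
  chain_length (s :: c) = `|s.2.2 - s.2.1| + chain_length c.
Proof. exact: big_cons. Qed.

Lemma mdist_le x y c : chain x c y -> mdist x y <= chain_length c.
Proof.
move=> xy; apply: ge_inf; last by exists c.
by exists 0 => _ [c' _ <-]; exact: chain_length_ge0.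
Qed.

Lemma chain_cat x y z c c' : chain x c y -> chain y c' z -> chain x (c ++ c') z.
Proof.
elim: c x => [|[e [t u]] c IH] x /=; first by move=> ->.
by case=> tL uL tx /IH uy /uy uz; split.
Qed.

Definition dparam a t := if a.2 then t else len a.1 - t.

Lemma dptE a t : dpt a t = ept a.1 (dparam a t).
Proof. by []. Qed.

Lemma dparamK a : involutive (dparam a).
Proof. by move=> t; rewrite /dparam; case: a.2; ring. Qed.

Lemma dparam_itv a t : (0 <= dparam a t <= len a.1) = (0 <= t <= len a.1).
Proof. by rewrite /dparam; case: a.2 => //; apply/idP/idP; lra. Qed.

Lemma dparam_dist a t u : `|dparam a u - dparam a t| = `|u - t|.
Proof.
rewrite /dparam; case: a.2 => //.
by rewrite (_ : len a.1 - u - (len a.1 - t) = t - u); [exact: distrC|ring].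
Qed.

Lemma dpt_chain a t u : 0 <= t <= len a.1 -> 0 <= u <= len a.1 ->
  exists2 c, chain (dpt a t) c (dpt a u) & chain_length c = `|u - t|.
Proof.
move=> tL uL; exists [:: (a.1, (dparam a t, dparam a u))].
  by rewrite /= !dparam_itv.
by rewrite /chain_length big_seq1 /= dparam_dist.
Qed.

Lemma mdist_dpt a t u : 0 <= t <= len a.1 -> 0 <= u <= len a.1 ->
  mdist (dpt a t) (dpt a u) <= `|u - t|.
Proof. by move=> tL uL; have [c /mdist_le + <-] := dpt_chain tL uL. Qed.

Definition edge_lipschitz F := forall e t u, 0 <= t <= len e -> 0 <= u <= len e ->
  `|F (ept e u) - F (ept e t)| <= `|u - t|.

(** Telescope along each chain. A chain must exist because the infimum of the empty set is 0, which
    would bound nothing. *)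
Lemma edge_lipschitz_mdist F x y : edge_lipschitz F -> (exists c, chain x c y) ->
  F y - F x <= mdist x y.
Proof.
move=> Flip [c0 xy0]; apply: lb_le_inf; first by exists (chain_length c0), c0.
move=> _ [c xy <-]; apply: le_trans (ler_norm _) _.
elim: c x xy {c0 xy0} => [|[e [t u]] c IH] x /=.
  by move=> ->; rewrite subrr normr0 chain_length_ge0.
case=> tL uL <- /IH uy; rewrite chain_length_cons /=.
rewrite (_ : F y - _ = (F (ept e u) - F (ept e t)) + (F y - F (ept e u))); last ring.
by apply: le_trans (ler_normD _ _) _; rewrite lerD // Flip.
Qed.

(* Tents are 1-Lipschitz along edges, hence bound the path metric from below. *)
Definition tent_profile (s d t : R) : R := Num.max 0 (Num.min (t - s) (s + 2 * d - t)).

Definition tent b (s d : R) x : R :=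
  if point_val x is inr (e, t) then
    if e == b.1 then tent_profile s d (dparam b t) else 0
  else 0.

Lemma tent_profile_lipschitz s d t u :
  `|tent_profile s d u - tent_profile s d t| <= `|u - t|.
Proof.
rewrite /tent_profile ler_norml.
case: (lerP (t - s)); case: (lerP (u - s)) => *;
  case: (lerP 0) => *; case: (lerP 0) => *; case: (ger0P (u - t)) => *; lra.
Qed.

Lemma tent_ept b s d e t : 0 <= s -> s + 2 * d <= len b.1 -> 0 <= t <= len e ->
  tent b s d (ept e t) = if e == b.1 then tent_profile s d (dparam b t) else 0.
Proof.
move=> s0 sL /andP[t0 tL].
have tent0 u : u = 0 \/ u = len b.1 -> tent_profile s d (dparam b u) = 0.
  move=> u0; apply/max_idPl; rewrite ge_min /dparam.
  by case: u0 => ->; case: ifP => _; apply/orP; [left|right|right|left]; lra.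
have [->|tn0] := eqVneq t 0.
  by rewrite ept0 /tent /= tent0; [case: ifP|left].
have [tl|tnl] := eqVneq t (len e).
  rewrite tl ept_len /tent /=; case: eqP => // ->.
  by rewrite tent0; [|right].
by rewrite /tent ept_inner // !lt_neqAle eq_sym tn0 t0 tnl.
Qed.

Lemma tent_lipschitz b s d : 0 <= s -> s + 2 * d <= len b.1 ->
  edge_lipschitz (tent b s d).
Proof.
move=> s0 sL e t u tL uL; rewrite !tent_ept //; case: eqP => [_|_].
  by apply: le_trans (tent_profile_lipschitz _ _ _ _) _; rewrite dparam_dist.
by rewrite subrr normr0.
Qed.

(** Why 3: a tent on an arm covers length [2 * d], and on a loop the last [d] is left to the arm
    that leaves [x] through the other end. *)
Definition radius x d := 0 < d /\ forall a t, arm x a t -> t + 3 * d <= len a.1.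

Lemma radius_le x d d' : radius x d -> 0 < d' <= d -> radius x d'.
Proof. by move=> [d0 xd] dd'; split=> [|a t /xd]; lra. Qed.

Lemma radius_ex x : exists d, radius x d.
Proof.
suff /near_at_right0P[d d0 xd] :
    \forall d \near 0^'+, forall a, forall t, arm x a t -> t + 3 * d <= len a.1.
  by exists d; split=> // a t; apply: xd; lra.
apply: filter_forall => a; apply/near_at_right0P.
have [[t at_]|noarm] := pselect (exists t, arm x a t); last first.
  by exists 1 => // d _ t at_; case: noarm; exists t.
exists ((len a.1 - t) / 3); first by case: at_; lra.
by move=> d dt t' at'; rewrite -(arm_uniq at_ at'); lra.
Qed.

(** * Small balls are stars *)

Section Star.
Variables (x : point Gam) (d : R).
Hypothesis xd : radius x d.

Let d_gt0 : 0 < d. Proof. by case: xd. Qed.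

Lemma arm_chain a t h : arm x a t -> 0 <= h <= d ->
  (exists c, chain x c (dpt a (t + h))) /\ (exists c, chain (dpt a (t + h)) c x).
Proof.
move=> at_ hd; have := xd.2 _ _ at_; case: at_ => tL <- td.
have [||c xc _] := @dpt_chain a t (t + h); [lra|lra|].
have [||c' cx _] := @dpt_chain a (t + h) t; [lra|lra|].
by split; [exists c|exists c'].
Qed.

Lemma tent_arm a t h : arm x a t -> 0 <= h <= d -> tent a t d (dpt a (t + h)) = h.
Proof.
move=> at_ hd; have := xd.2 _ _ at_; case: at_ => tL _ td.
rewrite dptE tent_ept ?dparam_itv ?eqxx ?dparamK //; [|lra|lra|lra].
by rewrite /tent_profile; case: (lerP (t + h - t)) => *; case: (lerP 0) => *; lra.
Qed.

Lemma tent_other_arm a b t s h : arm x a t -> arm x b s -> a != b ->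
  0 <= h <= d -> tent b s d (dpt a (t + h)) = 0.
Proof.
move=> at_ bs ab hd; have td := xd.2 _ _ at_; have sd := xd.2 _ _ bs.
have [tL _] := at_; have [sL _] := bs.
rewrite dptE tent_ept ?dparam_itv //; [|lra|lra|lra].
case: eqP => // ab1; apply/max_idPl; rewrite ge_min.
have ab2 : b.2 = ~~ a.2.
  move: ab ab1; case: (a) (b) => [e []] [e' []] //= + ee'; by rewrite ee' eqxx.
have -> : dparam b (dparam a (t + h)) = len b.1 - (t + h).
  rewrite /dparam -ab1 ab2; case: a.2 => //=; ring.
(* Opposite darts of one edge both leave [x]: either the edge is a loop at the vertex [x], or [x]
   lies inside it. *)
have [[t0 s0]|ts] : t = 0 /\ s = 0 \/ s = len b.1 - t.
- case: (pointP x) at_ bs => [v|e u eu].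
    by move=> /arm_vpt[-> _] /arm_vpt[-> _]; left.
  move=> /(arm_ept _ _ eu)[_ at2] /(arm_ept _ _ eu)[-> bt2]; right.
  by move: at2 bt2; rewrite ab2; case: a.2 => /= -> ->; ring.
- by apply/orP; right; rewrite -ab1 in sd *; lra.
- by apply/orP; left; lra.
Qed.

Lemma mdist_arm a t h : arm x a t -> 0 <= h <= d -> mdist x (dpt a (t + h)) = h.
Proof.
move=> at_ hd; have td := xd.2 _ _ at_; have [tL ax] := at_.
apply/eqP; rewrite eq_le; apply/andP; split.
  rewrite -ax; apply: le_trans (mdist_dpt _ _) _; [lra|lra|].
  by rewrite ger0_norm; lra.
have x0 : tent a t d x = 0 by rewrite -{1}ax -[t in dpt a t]addr0 tent_arm //; lra.
rewrite -[leLHS](tent_arm at_ hd) -[leLHS]subr0 -x0.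
apply: edge_lipschitz_mdist; last exact: (arm_chain at_ hd).1.
by apply: tent_lipschitz; lra.
Qed.

(** The tent on [b] is 0 at the first point and [d] at the second. This is what keeps the image of
    an arm under an isometry from switching arms. *)
Lemma mdist_arms a b t s h : arm x a t -> arm x b s -> a != b ->
  0 <= h <= d -> d <= mdist (dpt a (t + h)) (dpt b (s + d)).
Proof.
move=> at_ bs ab hd; have sd := xd.2 _ _ bs; have [sL bx] := bs.
have dd : 0 <= d <= d by lra.
rewrite -[leLHS](tent_arm bs dd) -[leLHS]subr0 -(tent_other_arm at_ bs ab hd).
apply: edge_lipschitz_mdist; first by apply: tent_lipschitz; lra.
have [_ [c ax]] := arm_chain at_ hd; have [[c' xb] _] := arm_chain bs dd.
by exists (c ++ c'); exact: chain_cat xb.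
Qed.

Lemma arm_germ_inj a b t s h : arm x a t -> arm x b s -> 0 < h <= d ->
  dpt a (t + h) = dpt b (s + h) -> a = b.
Proof.
move=> at_ bs hd E; apply/eqP/negPn/negP => ab.
have := tent_arm bs (h := h) ltac:(lra).
by rewrite -E (tent_other_arm at_ bs) //; lra.
Qed.

Definition on_star z r := exists a t h,
  [/\ arm x a t, 0 <= h <= r & z = dpt a (t + h)].

Lemma on_star_center e t u : 0 <= t <= len e -> 0 <= u <= len e ->
  ept e t = x -> t != u -> on_star (ept e u) `|u - t|.
Proof.
move=> tL uL tx tu; case: (ltP t u) tu => [tu _|ut tu].
  exists (e, true), t, (u - t); split; first by split=> //=; lra.
    by rewrite gtr0_norm; lra.
  by rewrite dpt_true; congr ept; ring.
have {}ut : u < t by rewrite lt_neqAle eq_sym tu.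
exists (e, false), (len e - t), (t - u); split.
- by split; [rewrite /=; lra|rewrite dpt_false -tx; congr ept; ring].
- by rewrite ltr0_norm; lra.
- by rewrite dpt_false; congr ept; ring.
Qed.

(** As [r <= 2 * d], a point of the star other than [x] lies strictly inside its dart, so the next
    segment stays on the same edge. *)
Lemma on_star_step r e t u : 0 <= t <= len e -> 0 <= u <= len e ->
  on_star (ept e t) r -> r <= 2 * d -> on_star (ept e u) (r + `|u - t|).
Proof.
move=> tL uL [a [t0 [h [at_ hr zE]]]] rd; have td := xd.2 _ _ at_.
have [t0L ax] := at_.
have r0 : 0 <= r by lra.
have [tu|tu] := eqVneq t u.
  exists a, t0, h; split=> //; last by rewrite -tu.
  by have := normr_ge0 (u - t); lra.
have [h0|h0] := eqVneq h 0.
  rewrite h0 addr0 ax in zE.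
  have [b [s [k [bs kr bE]]]] := on_star_center tL uL zE tu.
  by exists b, s, k; split=> //; lra.
have [e_eq t_eq] : e = a.1 /\ t = dparam a (t0 + h).
  have wL : 0 < dparam a (t0 + h) < len a.1.
    by rewrite /dparam; case: ifP => _; lra.
  move: zE; rewrite dptE => zE.
  have tn0 : t != 0.
    by apply/eqP => t0E; move: zE; rewrite t0E ept0 => /esym/(ept_neq_vpt wL).
  have tnl : t != len e.
    by apply/eqP => tE; move: zE; rewrite tE ept_len => /esym/(ept_neq_vpt wL).
  apply: ept_inj zE => //; rewrite !lt_neqAle eq_sym tn0 tnl /=; lra.
subst e; pose u' := dparam a u.
have u'L : 0 <= u' <= len a.1 by rewrite dparam_itv.
have -> : ept a.1 u = dpt a u' by rewrite dptE dparamK.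
have -> : `|u - t| = `|u' - (t0 + h)|.
  by rewrite t_eq -[RHS](dparam_dist a) dparamK.
have [tu'|ut'] := leP t0 u'.
  exists a, t0, (u' - t0); split=> //; last by congr dpt; ring.
  by have := ler_norm (u' - (t0 + h)); lra.
(* The segment goes back beyond [x], which therefore lies inside the edge, and it ends on the
   opposite arm. *)
exists (a.1, ~~ a.2), (len a.1 - t0), (t0 - u'); split.
- split=> /=; first lra.
  by rewrite -ax /dpt /=; case: a.2 => /=; congr ept; ring.
- by have := ler_norm (- (u' - (t0 + h))); rewrite normrN; lra.
- by rewrite /dpt /=; case: a.2 => /=; congr ept; ring.
Qed.

(** A chain from [x] shorter than [d] cannot leave the star. Positive distance also excludes the
    empty set of chains, whose infimum is 0. *)
Lemma near_on_star y : 0 < mdist x y < d ->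
  exists a t, arm x a t /\ y = dpt a (t + mdist x y).
Proof.
move=> /andP[xy0 xyd].
have chain_ne0 : [set chain_length c | c in [set c | chain x c y]] !=set0.
  apply/set0P/negP => /eqP E; move: xy0.
  by rewrite /mdist E inf0 ltxx.
have /(inf_adherent (eps := d - mdist x y) ltac:(lra)) :
    has_inf [set chain_length c | c in [set c | chain x c y]].
  by split=> //; exists 0 => _ [c _ <-]; exact: chain_length_ge0.
move=> [_ [c xcy <-]]; rewrite -/(mdist x y) => cd.
have {}cd : chain_length c < d by lra.
suff [a [t [h [at_ hc yE]]]] : on_star y (chain_length c).
  exists a, t; split=> //; rewrite {2}yE mdist_arm //; lra.
have from_star z r : on_star z r -> forall c, r + chain_length c <= d -> chain z c y ->
    on_star y (r + chain_length c).
  move=> zr c'; elim: c' z r zr => [|[e [t u]] c' IH] z r zr.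
    by rewrite /chain_length big_nil addr0 => _ <-.
  rewrite chain_length_cons /= addrA => rd [tL uL tz uy].
  have c'0 := chain_length_ge0 c'; have := normr_ge0 (u - t) => tu0.
  by apply: IH uy; [apply: on_star_step => //; rewrite ?tz //; lra|lra].
elim: c xcy cd => [/= xy|[e [t u]] c IH] /=.
  move: xy0; rewrite xy => yy _.
  have := @mdist_le y y [::] erefl.
  by rewrite /chain_length big_nil; lra.
move=> [tL uL tx uy]; rewrite chain_length_cons /= => cd.
have [tu|tu] := eqVneq t u.
  by move: uy cd; rewrite -tu tx subrr normr0 add0r.
by apply: from_star uy; [exact: on_star_center|lra].
Qed.

End Star.

End Metric.

(** * Action of an isometry on tangent directions *)

Section IsometryGerms.
Variables (R : realType) (Gam Gam' : metric_graph R).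
Variable phi : point Gam -> point Gam'.
Hypothesis phi_isom : forall x y, mdist (phi x) (phi y) = mdist x y.
Implicit Types (x : point Gam) (a : edge Gam * bool) (b : edge Gam' * bool).

Definition arm_corr x a b := exists t s d,
  [/\ 0 < d, arm x a t, arm (phi x) b s &
      forall h, 0 <= h <= d -> phi (dpt a (t + h)) = dpt b (s + h)].

Lemma arm_corr_ex x a t : arm x a t -> exists b, arm_corr x a b.
Proof.
move=> at_; have [r xr] := radius_ex x; have [r' xr'] := radius_ex (phi x).
(* Halved because [near_on_star] asks for a distance strictly below [r']. *)
pose d := Num.min r r' / 2.
have [r0 r'0] := (xr.1, xr'.1).
have m0 : 0 < Num.min r r' by rewrite lt_min r0.
have mr : Num.min r r' <= r by rewrite ge_min lexx.
have mr' : Num.min r r' <= r' by rewrite ge_min lexx orbT.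
have xd : radius x d by apply: radius_le xr _; rewrite /d; lra.
have xd' : radius (phi x) d by apply: radius_le xr' _; rewrite /d; lra.
have d0 : 0 < d by case: xd.
have on_arm h : 0 < h <= d ->
    exists b s, arm (phi x) b s /\ phi (dpt a (t + h)) = dpt b (s + h).
  move=> hd; have xh : mdist (phi x) (phi (dpt a (t + h))) = h.
    by rewrite phi_isom (mdist_arm xd) //; lra.
  have [|b [s [bs]]] := @near_on_star _ _ (phi x) r' xr' (phi (dpt a (t + h))).
    by rewrite xh; move: hd; rewrite /d; lra.
  by rewrite xh => E; exists b, s.
have [|b [s [bs bE]]] := on_arm d; first by rewrite d0 lexx.
exists b, t, s, d; split=> // h /andP[h0 hd].
have [h00|hn0] := eqVneq h 0; first by rewrite h00 !addr0 at_.2 bs.2.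
have [|c [s' [cs cE]]] := on_arm h; first by rewrite lt_neqAle eq_sym hn0 h0.
have [cb|cb] := eqVneq c b.
  by move: cs cE; rewrite cb => bs' ->; rewrite (arm_uniq bs' bs).
(* If the image at height [h] were on another arm [c], it would be at distance at least [d] from the
   image at height [d]; but the original points are at distance at most [d - h]. *)
have := mdist_arms xd' cs bs cb (h := h) ltac:(lra).
have td := xd.2 _ _ at_; have [tL _] := at_.
have : mdist (dpt a (t + h)) (dpt a (t + d)) <= `|t + d - (t + h)|.
  by apply: mdist_dpt; lra.
rewrite -cE -bE phi_isom ger0_norm; last lra.
by move=> *; exfalso; lra.
Qed.

Lemma arm_corr_uniqr x a b b' : arm_corr x a b -> arm_corr x a b' -> b = b'.
Proof.
move=> [t [s [d [d0 at_ bs E]]]] [t' [s' [d' [d'0 at_' bs' E']]]].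
rewrite -(arm_uniq at_ at_') in E'.
have [r xr] := radius_ex (phi x); have [r0 _] := xr.
pose h := Num.min r (Num.min d d').
have h0 : 0 < h by rewrite !lt_min r0 d0.
have [hr hd hd'] : [/\ h <= r, h <= d & h <= d'].
  by split; rewrite !ge_min lexx ?orbT.
apply: (arm_germ_inj xr bs bs' (h := h)); first lra.
by rewrite -E ?E' //; lra.
Qed.

Lemma arm_corr_slope (f : point Gam' -> R) x a b k : arm_corr x a b ->
  incoming_slope (f \o phi) x a k <-> incoming_slope f (phi x) b k.
Proof.
move=> [t [s [d [d0 at_ bs E]]]].
have E0 : phi (dpt a t) = dpt b s.
  by rewrite -[t]addr0 -[s]addr0 E // lexx ltW.
split=> /incoming_slopeP[t' xt' [d' d'0 fk]]; apply/incoming_slopeP.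
- exists s => //; rewrite -(arm_uniq at_ xt') /= in fk.
  exists (Num.min d d') => [|h]; first by rewrite lt_min d0.
  rewrite le_min => /andP[h0 /andP[hd hd']].
  by rewrite -E0 -E ?h0 //; apply: fk; rewrite h0.
- exists t => //; rewrite -(arm_uniq bs xt') /= in fk.
  exists (Num.min d d') => [|h]; first by rewrite lt_min d0.
  rewrite le_min => /andP[h0 /andP[hd hd']].
  by rewrite /= E0 E ?h0 //; apply: fk; rewrite h0.
Qed.

End IsometryGerms.

Section IsometryOrder.
Variables (R : realType) (Gam Gam' : metric_graph R).
Variables (phi : point Gam -> point Gam') (psi : point Gam' -> point Gam).
Hypotheses (phiK : cancel phi psi) (psiK : cancel psi phi).
Hypothesis phi_isom : forall x y, mdist (phi x) (phi y) = mdist x y.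

Lemma psi_isom x y : mdist (psi x) (psi y) = mdist x y.
Proof. by rewrite -phi_isom !psiK. Qed.

Lemma arm_corr_sym x a b : arm_corr phi x a b -> arm_corr psi (phi x) b a.
Proof.
move=> [t [s [d [d0 at_ bs E]]]]; exists s, t, d; rewrite phiK; split=> // h hd.
by rewrite -E ?phiK.
Qed.

Lemma loc_pl_isom (f : point Gam' -> R) : loc_pl f -> loc_pl (f \o phi).
Proof.
move=> floc a t tL; have at_ : arm (dpt a t) a t by [].
have [b ab] := arm_corr_ex phi_isom at_.
have [_ [s [_ [_ _ [sL sx] _]]]] := ab; have [k fk] := floc b s sL.
have /incoming_slopeP[t' at_' fk'] : incoming_slope (f \o phi) (dpt a t) a k.
  by apply/(arm_corr_slope _ _ ab)/incoming_slopeP; exists s.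
by exists k; rewrite (arm_uniq at_ at_').
Qed.

(** [arm_corr] matches the darts leaving [x] bijectively with those leaving [phi x], and all other
    darts contribute 0. Writing each term as a sum over its partners turns both sides into one
    double sum. *)
Lemma ord_isom (f : point Gam' -> R) x : ord (f \o phi) x = ord f (phi x).
Proof.
pose C a b := `[< arm_corr phi x a b >].
pose F a := xget 0 [set k | incoming_slope (f \o phi) x a k].
pose F' b := xget 0 [set k | incoming_slope f (phi x) b k].
have FF' a b : C a b -> F a = F' b.
  move=> /asboolP ab; congr (xget 0); apply/seteqP.
  by split=> k /=; rewrite (arm_corr_slope f k ab).
have sumC a : F a = \sum_(b | C a b) F a.
  have [[t at_]|noarm] := pselect (exists t, arm x a t).
    have [b ab] := arm_corr_ex phi_isom at_.
    rewrite (big_pred1 b) // => b'; apply/asboolP/eqP => [ab'|->//].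
    exact: arm_corr_uniqr ab' ab.
  rewrite big1 => [|b /asboolP[t [_ [_ [_ at_ _ _]]]]]; last by case: noarm; exists t.
  by apply: xget_no_slope => t at_; case: noarm; exists t.
have sumC' b : F' b = \sum_(a | C a b) F' b.
  have [[s bs]|noarm] := pselect (exists s, arm (phi x) b s).
    have [a ba] := arm_corr_ex psi_isom bs.
    have ab : arm_corr phi x a b.
      move: ba => [s' [t' [d [d0 bs' at_ E]]]]; rewrite phiK in at_.
      by exists t', s', d; split=> // h hd; rewrite -E ?psiK.
    rewrite (big_pred1 a) // => a'; apply/asboolP/eqP => [ab'|->//].
    exact: arm_corr_uniqr (arm_corr_sym ab') (arm_corr_sym ab).
  rewrite big1 => [|a /asboolP[_ [s [_ [_ _ bs _]]]]]; last by case: noarm; exists s.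
  by apply: xget_no_slope => s bs; case: noarm; exists s.
rewrite /ord (eq_bigr _ (fun a _ => sumC a)) [RHS](eq_bigr _ (fun b _ => sumC' b)).
rewrite [RHS](exchange_big_dep xpredT) //=.
by apply: eq_bigr => a _; apply: eq_bigr => b; exact: FF'.
Qed.

End IsometryOrder.

Lemma lin_eq_isom (R : realType) (Gam Gam' : metric_graph R)
    (phi : point Gam -> point Gam') (psi : point Gam' -> point Gam) X Y :
  cancel phi psi -> cancel psi phi ->
  (forall x y, mdist (phi x) (phi y) = mdist x y) ->
  lin_eq X Y -> lin_eq (map phi X) (map phi Y).
Proof.
move=> phiK psiK phi_isom [f fpl fE]; have psi_iso := psi_isom psiK phi_isom.
exists (f \o psi).
  exact/loc_pl_int_pl/(loc_pl_isom psi_iso)/int_pl_loc_pl.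
move=> x; rewrite (ord_isom psiK phiK psi_iso) fE !count_map.
by congr (_%:Z - _%:Z); apply: eq_count => y /=; rewrite (can2_eq phiK psiK).
Qed.

Lemma bn_property_isom (R : realType) (Gam Gam' : metric_graph R) r d n :
  isometric Gam Gam' -> bn_property Gam r d n -> bn_property Gam' r d n.
Proof.
move=> [phi [psi phiK psiK] phi_isom] bnG X Xn.
have [|X' XX' rkX] := bnG (map psi X); first by rewrite size_map.
have mapK : cancel (map psi) (map phi) by exact: mapK.
exists (map phi X') => [|Y Yr].
  by rewrite size_cat size_map -XX' size_cat size_map.
have [|Y' YX] := rkX (map psi Y); first by rewrite size_map.
exists (map phi Y').
by have := lin_eq_isom phiK psiK phi_isom YX; rewrite !map_cat !mapK.
Qed.

(** * Contraction of the edges of length zero *)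

Section Contraction.
Variables (R : realType) (G : graph) (l : edge G -> R).
Hypotheses (G_connected : connected_graph G) (l_ge0 : forall e, 0 <= l e).
Implicit Types (z : rep R G) (X Y : seq (rep R G)).

Local Notation C := (contracted_metric_graph G_connected l_ge0).

Definition contract_rep z : rep R C :=
  match z with
  | inl v => inl (component l v)
  | inr (e, t) => if insub e is Some e' then inr (e' : cedge l, t)
                  else inl (component l (src e))
  end.

Lemma contract_rep_valid z : rep_valid l z -> rep_valid (@len R C) (contract_rep z).
Proof. by case: z => [v|[e t]] //=; case: insubP => [e' _ <-|]. Qed.

Lemma component_eq (e : edge G) : l e = 0 -> component l (src e) = component l (tgt e).
Proof.
move=> le0; apply/val_inj => /=; apply/eqP.
rewrite (root_connect (adj_by_connect_sym _)); apply: connect1.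
by apply/existsP; exists e; rewrite le0 !eqxx.
Qed.

Lemma constant_on_component (T : Type) (f : vertex G -> T) :
  (forall e, l e = 0 -> f (src e) = f (tgt e)) ->
  forall v, f (val (component l v)) = f v.
Proof.
move=> fzero v; have /connectP[p pP ->] : connect (adj_by (fun e => l e == 0)) v
    (val (component l v)) by exact: connect_root.
elim: p v pP => //= w p IH v /andP[/existsP[e /andP[/eqP le0 vw]] /IH ->].
by case/orP: vw => /andP[/eqP <- /eqP <-]; rewrite fzero.
Qed.

Lemma componentK (v : cvertex l) : component l (val v) = v.
Proof. by apply/val_inj => /=; case: v => v /= /eqP. Qed.

Lemma sum_cedge (F : edge G -> int) : (forall e, l e = 0 -> F e = 0) ->
  \sum_e F e = \sum_(e : cedge l) F (val e).
Proof.
move=> F0; rewrite (bigID (fun e => 0 < l e)) /= [X in _ + X]big1 ?addr0.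
  rewrite (reindex_omap (val : cedge l -> _) insub) /=; last first.
    by move=> e le; rewrite insubT.
  by apply: eq_bigl => e; rewrite (valP e) valK eqxx.
by move=> e; rewrite lt_neqAle l_ge0 andbT negbK => /eqP/esym/F0.
Qed.

Lemma net_map (V : zmodType) X Y (h : rep R C -> V) :
  net (map contract_rep X) (map contract_rep Y) h = net X Y (fun z => h (contract_rep z)).
Proof. by rewrite /net !big_map. Qed.

Lemma rest_contract_rep (e : cedge l) z :
  rest (@len R C) e (contract_rep z) = rest l (val e) z.
Proof.
case: z => [v|[e' t]] //=; case: insubP => [e'' _ <-|] //=.
by case: eqP => // ->; rewrite (valP e).
Qed.

Lemma head_value_contract_rep (psi : cvertex l -> int) z :
  head_value (psi : vertex C -> int) (contract_rep z) = head_value (psi \o component l) z.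
Proof.
case: z => [v|[e t]] //=; case: insubP => [e' _ <-|] //=.
by rewrite lt_neqAle l_ge0 andbT negbK => /eqP/esym/component_eq->.
Qed.

Lemma net_rest_eq0 X Y e : all (rep_valid l) X -> all (rep_valid l) Y ->
  l e = 0 -> net X Y (rest l e) = 0.
Proof.
move=> Xv Yv le0; rewrite (eq_net (h' := fun=> 0) Xv Yv).
  by rewrite /net !big1 // subrr.
by case=> [|[e' t]] //= tl; case: eqP => // ee'; subst e'; lra.
Qed.

(** On an edge of length zero the edge equation only says that [phi] agrees at the two ends, so
    [phi] descends; conversely the slope there may be taken to be 0. The admissible test functions
    are exactly those pulled back from the contraction. *)
Lemma certified_contraction X Y : all (rep_valid l) X -> all (rep_valid l) Y ->
  certified l X Y <-> certified (@len R C) (map contract_rep X) (map contract_rep Y).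
Proof.
move=> Xv Yv; split=> [[phi [k [edge_eq vertex_eq]]]|[phi [k [edge_eq vertex_eq]]]].
  have phi0 e : l e = 0 -> phi (src e) = phi (tgt e).
    move=> le0; have := edge_eq e; rewrite le0 net_rest_eq0 // mulr0 subr0.
    by move/eqP; rewrite subr_eq0 => /eqP.
  exists (phi \o val), (k \o val); split=> [e|psi _] /=.
    rewrite !(constant_on_component phi0) edge_eq net_map; congr (_ - _).
    by apply: (eq_net Xv Yv) => z _; rewrite rest_contract_rep.
  rewrite net_map.
  rewrite (eq_net (h' := head_value (psi \o component l)) Xv Yv); last first.
    by move=> z _; rewrite head_value_contract_rep.
  rewrite -vertex_eq => [|e le0 /=]; last by rewrite component_eq.
  by rewrite sum_cedge // => e le0 /=; rewrite component_eq // subrr mulr0.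
exists (phi \o component l), (fun e => if insub e is Some e' then k e' else 0).
split=> [e|psi psi0] /=.
  case: insubP => [e' _ <-|].
    rewrite [LHS](edge_eq e') net_map; congr (_ - _).
    by apply: (eq_net Xv Yv) => z _; rewrite rest_contract_rep.
  rewrite lt_neqAle l_ge0 andbT negbK => /eqP/esym le0.
  by rewrite component_eq // subrr net_rest_eq0 // mul0r subrr.
rewrite sum_cedge => [|e le0]; last by rewrite psi0 // subrr mulr0.
rewrite (eq_net Xv Yv
  (h' := fun z => head_value (psi \o val : vertex C -> int) (contract_rep z))).
  rewrite -net_map -vertex_eq => [|e /eqP]; last by rewrite gt_eqF ?len_gt0.
  by apply: eq_bigr => e _; rewrite valK /= !(constant_on_component psi0).
move=> z _; rewrite (@head_value_contract_rep (psi \o val)).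
by case: z => [v|[e t]] /=; rewrite (constant_on_component psi0).
Qed.

Definition contracted_point z : point C := rep_point (contract_rep z).

Lemma certified_contracted_point X Y : all (rep_valid l) X -> all (rep_valid l) Y ->
  certified l X Y <-> lin_eq (map contracted_point X) (map contracted_point Y).
Proof.
move=> Xv Yv; have contract_rep_all Z : all (rep_valid l) Z ->
    all (rep_valid (@len R C)) (map contract_rep Z).
  by move=> /allP Zv; apply/allP => _ /mapP[z /Zv zv ->]; exact: contract_rep_valid.
rewrite certified_contraction // certified_lin_eq ?contract_rep_all //.
by rewrite -!map_comp.
Qed.

(* Unlike validity, openness for l implies validity for all nearby lengths. *)
Definition rep_open z : bool := if z is inr (e, t) then 0 < t < l e else true.

Definition point_rep (x : point C) : rep R G :=
  match point_val x with inl v => inl (val v) | inr (e, t) => inr (val e, t) end.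

Lemma point_rep_open x : rep_open (point_rep x).
Proof. by case: x => -[v|[e t]]. Qed.

Lemma point_repK x : contracted_point (point_rep x) = x.
Proof.
rewrite /contracted_point -[RHS]point_valK; congr rep_point.
by rewrite /point_rep; case: point_val => [v|[e t]] /=; rewrite ?componentK ?valK.
Qed.

Lemma rep_open_valid z : rep_open z -> rep_valid l z.
Proof. by case: z => [//|[e t]] /=; lra. Qed.

End Contraction.

(** * Limits of certificates *)

Section Bound.
Variables (R : realType) (G : graph) (l : edge G -> R).
Hypothesis l_ge0 : forall e, 0 <= l e.
Variables X Y : seq (rep R G).
Hypotheses (Xv : all (rep_valid l) X) (Yv : all (rep_valid l) Y).

Local Notation N := (size X + size Y)%N.

Lemma norm_net (V : realDomainType) (h : rep R G -> V) (b : V) :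
  (forall z, rep_valid l z -> `|h z| <= b) -> `|net X Y h| <= N%:R * b.
Proof.
move=> hb; have norm_sum Z : all (rep_valid l) Z ->
    `|\sum_(z <- Z) h z| <= (size Z)%:R * b.
  elim: Z => [|z Z IH] /=; first by rewrite big_nil normr0 mul0r.
  move=> /andP[/hb zb /IH Zb]; rewrite big_cons -natr1 mulrDl mul1r addrC.
  by apply: le_trans (ler_normD _ _) _; exact: lerD.
rewrite /net natrD mulrDl; apply: le_trans (ler_normB _ _) _.
by apply: lerD; exact: norm_sum.
Qed.

Variables (phi : vertex G -> R) (k : edge G -> int).
Hypothesis cert : certificate l X Y phi k.

(** Edges of length zero leave [k] free in both conditions, so no bound on [k] itself can hold. *)
Let normalized e := if l e == 0 then 0 else k e.

Lemma certificate_normalized : certificate l X Y phi normalized.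
Proof.
case: cert => edge_eq vertex_eq; split=> [e|psi psi0].
  rewrite edge_eq /normalized; case: eqP => // ->; by rewrite !mulr0.
rewrite -(vertex_eq _ psi0); apply: eq_bigr => e _; rewrite /normalized.
by case: eqP => // /psi0 ->; rewrite !subrr !mulr0.
Qed.

(** The points on [e] contribute at most [N * l e] to the edge equation, so the sign of the
    variation of [phi] bounds the slope on one side. *)
Lemma flow_gradient e : 0 < l e ->
  (phi (src e) <= phi (tgt e) -> - N%:Z <= k e) /\
  (phi (tgt e) <= phi (src e) -> k e <= N%:Z).
Proof.
move=> le0; have /norm_net : forall z, rep_valid l z -> `|rest l e z| <= l e.
  case=> [v|[e' t]] /=; first by rewrite normr0 ltW.
  case: eqP => [->|_] tl; last by rewrite normr0 ltW.
  by rewrite ger0_norm; lra.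
have := cert.1 e; set D := net _ _ _; rewrite ler_norml => kE /andP[D1 D2].
split=> phi_le.
  rewrite -(ler_int R) -(ler_pM2r le0) mulrNz mulNr; lra.
by rewrite -(ler_int R) -(ler_pM2r le0); lra.
Qed.

(* Cut argument: the edges crossing a level set of phi all carry flow in the
   same direction (up to N), and the total flow across it is at most N. *)
Lemma normalized_bound e : `|normalized e| <= N%:Z * (#|edge G|.+1)%:Z.
Proof.
pose cut (c : R) u : int := Posz (c < phi u)%R.
have phi0 e' : l e' = 0 -> phi (src e') = phi (tgt e').
  move=> le0; have := cert.1 e'; rewrite le0 mulr0 net_rest_eq0 // subr0.
  by move/eqP; rewrite subr_eq0 => /eqP.
have cut_term c e' : - N%:Z <= normalized e' * (cut c (tgt e') - cut c (src e')).
  rewrite /normalized /cut; case: eqP => [/phi0 ->|/eqP le0]; first lia.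
  have {}le0 : 0 < l e' by rewrite lt_neqAle eq_sym le0 l_ge0.
  have [gr1 gr2] := flow_gradient le0.
  case: ltP => ct; case: ltP => cs /=; rewrite ?subrr ?subr0 ?sub0r ?mulr1 ?mulr0; try lia.
    by apply: gr1; lra.
  by rewrite mulrN1 lerN2; apply: gr2; lra.
have cut_total c : \sum_e' normalized e' * (cut c (tgt e') - cut c (src e')) <= N%:Z.
  rewrite (certificate_normalized.2 (cut c)) => [|e' /phi0 e'0]; last by rewrite /cut e'0.
  have /norm_net : forall z, rep_valid l z -> `|head_value (cut c) z| <= 1.
    by case=> [v|[e' t]] _ /=; rewrite /cut; case: ltP.
  by rewrite mulr1 ler_norml natz => /andP[].
(* The total is at most [N], and each of the other edges, fewer than [#|edge G|], can offset at most
   [N]. *)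
have cut_edge c : normalized e * (cut c (tgt e) - cut c (src e)) <=
    N%:Z * (#|edge G|.+1)%:Z.
  have := cut_total c; rewrite (bigD1 e) //=.
  have : - (N%:Z * (#|edge G|)%:Z) <=
      \sum_(i | i != e) normalized i * (cut c (tgt i) - cut c (src i)).
    apply: le_trans (ler_sum _ (fun i _ => cut_term c i)).
    rewrite sumr_const -mulr_natr natz mulNr lerN2 ler_wpM2l //.
    by rewrite lez_nat max_card.
  rewrite intS [_ * (1 + _)]mulrDr mulr1.
  move: (\sum_(i | _) _) (normalized e * _) (_ * (#|edge G|)%:Z) => s x m; lia.
have [le0|] := eqVneq (l e) 0; first by rewrite /normalized le0 eqxx normr0.
move=> le0'; have le0 : 0 < l e by rewrite lt_neqAle eq_sym le0' l_ge0.
have kE : normalized e = k e by rewrite /normalized (negbTE le0').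
have [gr1 gr2] := flow_gradient le0.
have N_le : N%:Z <= N%:Z * (#|edge G|.+1)%:Z by rewrite -PoszM lez_nat leq_pmulr.
(* On the side that [flow_gradient] does not bound, cut at the value of [phi] at the lower end of
   [e]; as [cut] is strict, [e] then crosses the cut. *)
rewrite kE in cut_edge *; rewrite ler_norml; apply/andP; split.
  case: (leP (phi (src e)) (phi (tgt e))) => [/gr1|lt_phi]; first lia.
  by have := cut_edge (phi (tgt e)); rewrite /cut ltxx lt_phi /=; lia.
case: (leP (phi (tgt e)) (phi (src e))) => [/gr2|lt_phi]; first lia.
by have := cut_edge (phi (src e)); rewrite /cut ltxx lt_phi /=; lia.
Qed.

End Bound.

Lemma certified_bounded (R : realType) (G : graph) (l : edge G -> R) X Y :
  (forall e, 0 <= l e) -> all (rep_valid l) X -> all (rep_valid l) Y ->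
  certified l X Y -> exists phi k, certificate l X Y phi k /\
    forall e, `|k e| <= (size X + size Y)%N%:Z * (#|edge G|.+1)%:Z.
Proof.
move=> l_ge0 Xv Yv [phi [k cert]].
exists phi, (fun e => if l e == 0 then 0 else k e); split.
  exact: certificate_normalized cert.
exact: (normalized_bound l_ge0 Xv Yv cert).
Qed.

Lemma cvg_near_eq (T : Type) (W : nbhsType) (F : set_system T) {FF : Filter F}
    (f g : T -> W) (y : W) :
  (\forall t \near F, f t = g t) -> g @ F --> y -> f @ F --> y.
Proof.
by move=> fg; apply: cvg_trans; apply: near_eq_cvg; apply: filterS fg => t.
Qed.

(** * Limits of points along an ultrafilter *)

Section Ultrafilter.
Variables (T : Type) (U : set_system T).
Hypothesis U_ultra : UltraFilter U.

Lemma ultra_finite (I : finType) (f : T -> I) : exists i, \forall t \near U, f t = i.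
Proof.
apply: contrapT => /forallNP noconst.
have /filter_forall : forall i, \forall t \near U, f t <> i.
  move=> i; have [/noconst//|//] := in_ultra_setVsetC [set t | f t = i] U_ultra.
by move=> /filter_ex[t /(_ (f t))].
Qed.

Lemma ultra_bounded_int (f : T -> int) (B : int) :
  (\forall t \near U, `|f t| <= B) -> exists i, \forall t \near U, f t = i.
Proof.
move=> fB; pose g t : 'I_(`|B|%N * 2).+1 := inord (absz (f t + B)).
have [i gi] := ultra_finite g; exists (i%:Z - B).
near=> t; have ft : `|f t| <= B by near: t.
have <- : g t = i by near: t.
rewrite /g inordK; move: ft; rewrite ler_norml; lia.
Unshelve. all: by end_near.
Qed.

Lemma ultra_cvg (R : realType) (f : T -> R) (a b : R) :
  (\forall t \near U, a <= f t <= b) -> exists y : R, f @ U --> y.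
Proof.
move=> fab; have := @segment_compact R a b.
move=> /(_ (fmap f U) _)[].
  by apply: filterS fab => t; rewrite /= in_itv.
move=> y [_ fy]; exists y => A yA.
have [//|nA] := in_ultra_setVsetC (f @^-1` A) U_ultra.
by have [z []] := fy (~` A) A nA yA.
Qed.

Variables (R : realType) (G : graph) (L : T -> edge G -> R) (l : edge G -> R).
Hypothesis L_cvg : forall e, L^~ e @ U --> l e.
Implicit Types (z : rep R G) (Z : seq (rep R G)).

(** The place is eventually constant and only the parameter converges. A limit at an end of the edge
    stays recorded on that edge, which is why [rep_valid] has closed bounds. *)
Definition rep_lim (x : T -> rep R G) z : Prop :=
  match z with
  | inl v => \forall t \near U, x t = inl v
  | inr (e, s) => exists2 s_ : T -> R,
      (\forall t \near U, x t = inr (e, s_ t)) & s_ @ U --> s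
  end.

Lemma rep_lim_cst z : rep_lim (fun=> z) z.
Proof.
case: z => [v|[e s]] /=; first by near=> t.
by exists (fun=> s); [near=> t|exact: cvg_cst].
Unshelve. all: by end_near.
Qed.

Lemma rep_lim_ex (x : T -> rep R G) :
  (\forall t \near U, rep_valid (L t) (x t)) ->
  exists2 z, rep_valid l z & rep_lim x z.
Proof.
move=> xv; pose place t : vertex G + edge G :=
  match x t with inl v => inl v | inr (e, _) => inr e end.
have [[v|e] xP] := ultra_finite place.
  exists (inl v) => //=; near=> t; have : place t = inl v by near: t.
  by rewrite /place; case: (x t) => [u [->]|[]].
pose s_ t := if x t is inr (_, s) then s else 0.
have xE : \forall t \near U, x t = inr (e, s_ t).
  near=> t; have : place t = inr e by near: t.
  by rewrite /place /s_; case: (x t) => [//|[e' s] [->]].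
have sL : \forall t \near U, 0 <= s_ t <= L t e.
  near=> t; have : rep_valid (L t) (x t) by near: t.
  by rewrite (near xE t).
(* Eventually [L t e < l e + 1], so the parameters lie in a fixed compact segment. *)
have [|s s_s] := @ultra_cvg R s_ 0 (l e + 1).
  near=> t; have /andP[-> /=] : 0 <= s_ t <= L t e by near: t.
  move=> /le_trans; apply; apply: ltW.
  by near: t; apply: (cvgr_lt _ (@L_cvg e)); rewrite ltrDl.
exists (inr (e, s)); last by exists s_.
rewrite /=; apply/andP; split; rewrite leNgt; apply/negP => s_lt.
  have : \forall t \near U, False.
    near=> t; have /andP[+ _] : 0 <= s_ t <= L t e by near: t.
    by apply/negP; rewrite -ltNge; near: t; exact: (cvgr_lt _ s_s).
  by move=> /filter_ex[].
have : \forall t \near U, False.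
  near=> t; have /andP[_] : 0 <= s_ t <= L t e by near: t.
  apply/negP; rewrite -ltNge -subr_gt0; near: t.
  by apply: (cvgr_gt _ (cvgB s_s (@L_cvg e))); rewrite subr_gt0.
by move=> /filter_ex[].
Unshelve. all: by end_near.
Qed.

Fixpoint seq_lim (X : T -> seq (rep R G)) Z : Prop :=
  if Z is z :: Z' then exists x X', [/\ \forall t \near U, X t = x t :: X' t,
    rep_lim x z & seq_lim X' Z']
  else \forall t \near U, X t = [::].

Lemma seq_lim_cst Z : seq_lim (fun=> Z) Z.
Proof.
elim: Z => [|z Z IH] /=; first by near=> t.
by exists (fun=> z), (fun=> Z); split; [near=> t|exact: rep_lim_cst|].
Unshelve. all: by end_near.
Qed.

Lemma seq_lim_cat X X' Z Z' : seq_lim X Z -> seq_lim X' Z' ->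
  seq_lim (fun t => X t ++ X' t) (Z ++ Z').
Proof.
elim: Z X => [|z Z IH] X /= XZ XZ'.
  elim: Z' X' XZ' => [|z' Z' IH'] X' /= X'Z'.
    by near=> t; rewrite (near XZ t) // (near X'Z' t).
  have [x [X'' [X'E xz X''Z']]] := X'Z'; exists x, X''; split=> //.
  by near=> t; rewrite (near XZ t) // (near X'E t).
have [x [X'' [XE xz X''Z]]] := XZ.
exists x, (fun t => X'' t ++ X' t); split=> //; last exact: IH.
by near=> t; rewrite (near XE t).
Unshelve. all: by end_near.
Qed.

Lemma seq_lim_ex n (X : T -> seq (rep R G)) :
  (\forall t \near U, size (X t) = n /\ all (rep_valid (L t)) (X t)) ->
  exists Z, [/\ size Z = n, all (rep_valid l) Z & seq_lim X Z].
Proof.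
elim: n X => [|n IH] X XP.
  exists [::]; split=> //=; near=> t.
  have [+ _] : size (X t) = 0%N /\ all (rep_valid (L t)) (X t) by near: t.
  exact: size0nil.
have [z0 _] : exists v : rep R G, True.
  have /filter_ex[t] := XP; case: (X t) => [[]//|z Z _]; first by exists z.
pose x t := head z0 (X t).
have XE : \forall t \near U, X t = x t :: behead (X t).
  near=> t; have [] : size (X t) = n.+1 /\ all (rep_valid (L t)) (X t) by near: t.
  by rewrite /x; case: (X t).
have [|z zv xz] := @rep_lim_ex x.
  near=> t; have [_] : size (X t) = n.+1 /\ all (rep_valid (L t)) (X t) by near: t.
  by rewrite (near XE t) //= => /andP[].
have [|Z [Zn Zv X'Z]] := IH (fun t => behead (X t)).
  near=> t; have [] : size (X t) = n.+1 /\ all (rep_valid (L t)) (X t) by near: t.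
  by rewrite (near XE t) //= => -[->] /andP[_].
exists (z :: Z); split; rewrite /= ?Zn ?zv //.
by exists x, (fun t => behead (X t)).
Unshelve. all: by end_near.
Qed.

Lemma seq_lim_size X Z : seq_lim X Z -> \forall t \near U, size (X t) = size Z.
Proof.
elim: Z X => [|z Z IH] X /=; first by apply: filterS => t ->.
move=> [x [X' [XE _ /IH X'Z]]]; near=> t.
by rewrite (near XE t) //= (near X'Z t).
Unshelve. all: by end_near.
Qed.

(** [head_value] sees only the place of a point, so these sums are eventually equal, not just
    convergent, and simultaneously for all [psi]. *)
Lemma seq_lim_head X Z : seq_lim X Z -> \forall t \near U, forall psi,
  \sum_(z <- X t) head_value psi z = \sum_(z <- Z) head_value psi z.
Proof.
elim: Z X => [|z Z IH] X /=; first by apply: filterS => t ->.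
move=> [x [X' [XE xz /IH X'Z]]].
have xz' : \forall t \near U, forall psi, head_value psi (x t) = head_value psi z.
  case: z xz => [v xv|[e s] [s_ xE _]].
    by apply: filterS xv => t ->.
  by apply: filterS xE => t ->.
by near=> t => psi; rewrite (near XE t) // !big_cons (near xz' t) // (near X'Z t).
Unshelve. all: by end_near.
Qed.

Lemma seq_lim_rest e X Z : seq_lim X Z ->
  (fun t => \sum_(z <- X t) rest (L t) e z) @ U --> \sum_(z <- Z) rest l e z.
Proof.
elim: Z X => [|z Z IH] X /=.
  move=> X0; rewrite big_nil; apply: cvg_near_cst.
  by apply: filterS X0 => t ->; rewrite big_nil.
move=> [x [X' [XE xz /IH X'Z]]]; rewrite big_cons.
apply: (cvg_near_eq (g := fun t => rest (L t) e (x t) +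
    \sum_(z <- X' t) rest (L t) e z)).
  by near=> t; rewrite (near XE t) // big_cons.
apply: cvgD => //; case: z xz => [v xv|[e' s] [s_ xE s_s]] /=.
  by apply: cvg_near_cst; apply: filterS xv => t ->.
apply: (cvg_near_eq (g := fun t => if e' == e then L t e - s_ t else 0)).
  by apply: filterS xE => t ->.
by case: eqP => _; [apply: cvgB|exact: cvg_cst].
Unshelve. all: by end_near.
Qed.

End Ultrafilter.

Section CertifiedLimit.
Variables (T : Type) (U : set_system T).
Hypothesis U_ultra : UltraFilter U.
Variables (R : realType) (G : graph) (L : T -> edge G -> R) (l : edge G -> R).
Hypothesis G_connected : connected_graph G.
Hypotheses (L_ge0 : forall t e, 0 <= L t e) (l_ge0 : forall e, 0 <= l e).
Hypothesis L_cvg : forall e, L^~ e @ U --> l e.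

Lemma certified_limit (X_ Y_ : T -> seq (rep R G)) X Y :
  seq_lim U X_ X -> seq_lim U Y_ Y ->
  (\forall t \near U, [/\ all (rep_valid (L t)) (X_ t),
     all (rep_valid (L t)) (Y_ t) & certified (L t) (X_ t) (Y_ t)]) ->
  certified l X Y.
Proof.
move=> XX YY certXY.
pose B := (size X + size Y)%N%:Z * (#|edge G|.+1)%:Z.
have [p pP] : exists p : T -> (vertex G -> R) * (edge G -> int),
    \forall t \near U, certificate (L t) (X_ t) (Y_ t) (p t).1 (p t).2 /\
      forall e, `|(p t).2 e| <= B.
  suff /choice[p pP] : forall t, exists q : (vertex G -> R) * (edge G -> int),
      [/\ all (rep_valid (L t)) (X_ t), all (rep_valid (L t)) (Y_ t) &
          certified (L t) (X_ t) (Y_ t)] ->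
      certificate (L t) (X_ t) (Y_ t) q.1 q.2 /\ forall e, `|q.2 e| <=
        (size (X_ t) + size (Y_ t))%N%:Z * (#|edge G|.+1)%:Z.
    have sX := seq_lim_size U_ultra XX; have sY := seq_lim_size U_ultra YY.
    exists p; near=> t; rewrite /B -(near sX t) // -(near sY t) //.
    by apply: pP; near: t.
  move=> t; have [[Xv Yv]|none] := pselect [/\ all (rep_valid (L t)) (X_ t),
     all (rep_valid (L t)) (Y_ t) & certified (L t) (X_ t) (Y_ t)].
    by move=> /(certified_bounded (@L_ge0 t) Xv Yv)[phi [k ?]]; exists (phi, k).
  by exists (fun=> 0, fun=> 0).
pose phi_ t := (p t).1; pose k_ t := (p t).2.
have /choice[k kP] : forall e, exists i, \forall t \near U, k_ t e = i.
  move=> e; apply: (ultra_bounded_int U_ultra (B := B)).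
  by apply: filterS pP => t [_ /(_ e)].
have diff_cvg e : (fun t => phi_ t (tgt e) - phi_ t (src e)) @ U -->
    (k e)%:~R * l e - net X Y (rest l e).
  apply: (cvg_near_eq
    (g := fun t => (k e)%:~R * L t e - net (X_ t) (Y_ t) (rest (L t) e))).
    have kPe := kP e; near=> t; rewrite -(near kPe t) //.
    have [[edge_eq _] _] : certificate (L t) (X_ t) (Y_ t) (p t).1 (p t).2 /\
      (forall e, `|(p t).2 e| <= B) by near: t.
    exact: edge_eq.
  apply: cvgB; first by apply: cvgMl_tmp; exact: L_cvg.
  have cX := seq_lim_rest U_ultra L_cvg (e := e) XX.
  have cY := seq_lim_rest U_ultra L_cvg (e := e) YY.
  exact: (cvgB cX cY).
have [/card_gt0P[v0 _] connG] := G_connected.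
(* The potentials are determined only up to a constant and may diverge. Subtracting the value at
   [v0] leaves sums of differences along a path, which converge edge by edge. *)
have /choice[phi phiP] : forall v, exists y : R, (fun t => phi_ t v - phi_ t v0) @ U --> y.
  have walk q u : path (adj_by predT) u q ->
      (exists y : R, (fun t => phi_ t u - phi_ t v0) @ U --> y) ->
      exists y : R, (fun t => phi_ t (last u q) - phi_ t v0) @ U --> y.
    elim: q u => [//|w q IH] u /= /andP[/existsP[e /= uw] wq] [y uy].
    apply: IH wq _; case/orP: uw => /andP[/eqP eu /eqP ew]; subst u w.
      exists (((k e)%:~R * l e - net X Y (rest l e)) + y).
      apply: (cvg_near_eq (g := fun t => (phi_ t (tgt e) - phi_ t (src e)) +
        (phi_ t (src e) - phi_ t v0))); last exact: (cvgD (diff_cvg e) uy).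
      by near=> t; rewrite addrA subrK.
    exists (y - ((k e)%:~R * l e - net X Y (rest l e))).
    apply: (cvg_near_eq (g := fun t => (phi_ t (tgt e) - phi_ t v0) -
      (phi_ t (tgt e) - phi_ t (src e)))); last exact: (cvgB uy (diff_cvg e)).
    by near=> t; ring.
  move=> v; have /connectP[q qP ->] := connG v0 v; apply: walk qP _.
  by exists 0; apply: cvg_near_cst; near=> t; rewrite subrr.
exists phi, k; split=> [e|psi psi0].
  apply: (norm_cvg_unique _ (diff_cvg e)).
  apply: (cvg_near_eq (g := fun t => (phi_ t (tgt e) - phi_ t v0) -
    (phi_ t (src e) - phi_ t v0))); last exact: (cvgB (phiP (tgt e)) (phiP (src e))).
  by near=> t; ring.
(* Edges contracted at [t] are eventually contracted in the limit, so a test function admissible for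
   [l] is admissible for [L t]. *)
have zeroP : \forall t \near U, forall e, L t e = 0 -> l e = 0.
  apply: filter_forall => e; have := l_ge0 e; rewrite le_eqVlt.
  case/orP => [/eqP <-|le0]; first by near=> t.
  apply: filterS (cvgr_gt _ (@L_cvg e) _ le0) => t Le0 Le.
  by rewrite Le ltxx in Le0.
have kall : \forall t \near U, forall e, k_ t e = k e.
  by apply: filter_forall => e; exact: kP.
have hX := seq_lim_head U_ultra XX; have hY := seq_lim_head U_ultra YY.
have : \forall t \near U, \sum_e k e * (psi (tgt e) - psi (src e)) =
    net X Y (head_value psi).
  near=> t.
  have [[_ vertex_eq] _] : certificate (L t) (X_ t) (Y_ t) (p t).1 (p t).2 /\
    (forall e, `|(p t).2 e| <= B) by near: t.
  rewrite /net -(near hX t) // -(near hY t) // -[RHS]vertex_eq.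
    by apply: eq_bigr => e _; rewrite -(near kall t).
  move=> e Le0; apply: psi0; move: e Le0; near: t; exact: zeroP.
by move=> /filter_ex[].
Unshelve. all: by end_near.
Qed.

End CertifiedLimit.

(** * Upper semicontinuity *)

Section BrillNoetherLimit.
Variables (T : Type) (U : set_system T).
Hypothesis U_ultra : UltraFilter U.
Variables (R : realType) (G : graph) (L : T -> edge G -> R) (l : edge G -> R).
Hypothesis G_connected : connected_graph G.
Hypotheses (L_ge0 : forall t e, 0 <= L t e) (l_ge0 : forall e, 0 <= l e).
Hypothesis L_cvg : forall e, L^~ e @ U --> l e.

Local Notation Gam_ t := (contracted_metric_graph G_connected (@L_ge0 t)).
Local Notation Gam := (contracted_metric_graph G_connected l_ge0).

Lemma near_rep_open (X : seq (rep R G)) : all (rep_open l) X ->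
  \forall t \near U, all (rep_valid (L t)) X.
Proof.
elim: X => [|z X IH] /=; first by move=> _; near=> t.
move=> /andP[zo /IH X_near].
suff z_near : \forall t \near U, rep_valid (L t) z.
  by near=> t; rewrite (near z_near t) // (near X_near t).
case: z zo => [v _|[e s] /= /andP[s0 sl]]; first by near=> t.
apply: filterS (cvgr_gt _ (@L_cvg e) _ sl) => t sL.
by rewrite !ltW.
Unshelve. all: by end_near.
Qed.

Lemma bn_property_limit r d n :
  (\forall t \near U, bn_property (Gam_ t) r d n) -> bn_property Gam r d n.
Proof.
move=> bn_near X Xn.
have point_rep_map (l' : edge G -> R) (l'0 : forall e, 0 <= l' e)
    (Z : seq (point (contracted_metric_graph G_connected l'0))) :
    map (contracted_point G_connected l'0)
      (map (@point_rep _ _ _ G_connected l'0) Z) = Z /\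
    all (rep_open l') (map (@point_rep _ _ _ G_connected l'0) Z).
  split; first by rewrite -map_comp map_id_in // => x _; exact: point_repK.
  by apply/allP => _ /mapP[x _ ->]; exact: point_rep_open.
have open_valid (l' : edge G -> R) (Z : seq (rep R G)) :
    all (rep_open l') Z -> all (rep_valid l') Z.
  exact/sub_all/rep_open_valid.
have [XE Xo] := point_rep_map _ l_ge0 X; set RX := map _ X in XE Xo.
have RXn : size RX = (r + n)%N by rewrite size_map.
have [F_ F_P] : exists F_ : T -> seq (rep R G), forall t,
    all (rep_valid (L t)) RX -> bn_property (Gam_ t) r d n ->
    [/\ all (rep_valid (L t)) (F_ t), size (RX ++ F_ t) = d &
      forall RY, size RY = r -> all (rep_valid (L t)) RY -> exists H,
        all (rep_valid (L t)) H /\ certified (L t) (RY ++ H) (RX ++ F_ t)].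
  suff /choice[F_ F_P] : forall t, exists F, all (rep_valid (L t)) RX ->
      bn_property (Gam_ t) r d n ->
    [/\ all (rep_valid (L t)) F, size (RX ++ F) = d &
      forall RY, size RY = r -> all (rep_valid (L t)) RY -> exists H,
        all (rep_valid (L t)) H /\ certified (L t) (RY ++ H) (RX ++ F)] by exists F_.
  move=> t; have [bn_t|] := pselect (bn_property (Gam_ t) r d n); last by exists [::].
  have [|X' XX' rkX] := bn_t (map (contracted_point G_connected (@L_ge0 t)) RX).
    by rewrite size_map.
  have [X'E X'o] := point_rep_map _ (@L_ge0 t) X'; set F := map _ X' in X'E X'o.
  exists F => RXv _; split; first exact: open_valid.
    by rewrite -XX' -X'E !size_cat !size_map.
  move=> RY RYr RYv.
  have [|Y' YX] := rkX (map (contracted_point G_connected (@L_ge0 t)) RY).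
    by rewrite size_map.
  have [Y'E Y'o] := point_rep_map _ (@L_ge0 t) Y'; set H := map _ Y' in Y'E Y'o.
  exists H; split; first exact: open_valid.
  apply/(certified_contracted_point G_connected (@L_ge0 t)).
  - by rewrite all_cat RYv open_valid.
  - by rewrite all_cat RXv open_valid.
  - by rewrite !map_cat Y'E X'E.
have RX_near := near_rep_open Xo.
have [|F [Fn Fv FF]] := seq_lim_ex U_ultra L_cvg (n := (d - (r + n))%N) (X := F_).
  near=> t; have RXv : all (rep_valid (L t)) RX by near: t.
  have bn_t : bn_property (Gam_ t) r d n by near: t.
  have [F_v F_d _] := F_P t RXv bn_t; split=> //.
  by move: F_d; rewrite size_cat RXn; lia.
exists (map (contracted_point G_connected l_ge0) F).
  have /filter_ex[t RXF] : \forall t \near U, size (RX ++ F_ t) = d.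
    near=> t; have RXv : all (rep_valid (L t)) RX by near: t.
    have bn_t : bn_property (Gam_ t) r d n by near: t.
    by have [] := F_P t RXv bn_t.
  by move: RXF; rewrite !size_cat size_map Fn RXn Xn; lia.
move=> Y Yr; have [YE Yo] := point_rep_map _ l_ge0 Y; set RY := map _ Y in YE Yo.
have RYr : size RY = r by rewrite size_map.
have RY_near := near_rep_open Yo.
have [H_ H_P] : exists H_ : T -> seq (rep R G), forall t,
    all (rep_valid (L t)) RX -> bn_property (Gam_ t) r d n ->
    all (rep_valid (L t)) RY ->
    all (rep_valid (L t)) (H_ t) /\ certified (L t) (RY ++ H_ t) (RX ++ F_ t).
  suff /choice[H_ H_P] : forall t, exists H, all (rep_valid (L t)) RX ->
    bn_property (Gam_ t) r d n -> all (rep_valid (L t)) RY ->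
    all (rep_valid (L t)) H /\ certified (L t) (RY ++ H) (RX ++ F_ t) by exists H_.
  move=> t.
  have [[RXv bn_t RYv]|none] := pselect [/\ all (rep_valid (L t)) RX,
     bn_property (Gam_ t) r d n & all (rep_valid (L t)) RY].
    by have [_ _ /(_ RY RYr RYv)[H HP]] := F_P t RXv bn_t; exists H.
  by exists [::] => RXv bn_t RYv; case: none.
have near_all : \forall t \near U, [/\ all (rep_valid (L t)) (RY ++ H_ t),
     all (rep_valid (L t)) (RX ++ F_ t), certified (L t) (RY ++ H_ t) (RX ++ F_ t) &
     size (RY ++ H_ t) = d].
  near=> t; have RXv : all (rep_valid (L t)) RX by near: t.
  have bn_t : bn_property (Gam_ t) r d n by near: t.
  have RYv : all (rep_valid (L t)) RY by near: t.
  have [Fv' Fd _] := F_P t RXv bn_t; have [Hv Hc] := H_P t RXv bn_t RYv.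
  have Yv : all (rep_valid (L t)) (RY ++ H_ t) by rewrite all_cat RYv.
  have Xv : all (rep_valid (L t)) (RX ++ F_ t) by rewrite all_cat RXv.
  split=> //; rewrite -Fd.
  move: Hc => /(certified_contracted_point G_connected (@L_ge0 t) Yv Xv).
  by move=> /lin_eq_size; rewrite !size_map.
have [|H [Hn Hv HH]] := seq_lim_ex U_ultra L_cvg (n := (d - r)%N) (X := H_).
  apply: filterS near_all => t [+ _ _]; rewrite all_cat size_cat RYr => /andP[_ ->].
  by move=> HE; split=> //; lia.
exists (map (contracted_point G_connected l_ge0) H).
rewrite -YE -XE -!map_cat; apply/certified_contracted_point.
- by rewrite all_cat (open_valid _ _ Yo).
- by rewrite all_cat (open_valid _ _ Xo).
apply: (certified_limit U_ultra G_connected L_ge0 l_ge0 L_cvg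
  (X_ := fun t => RY ++ H_ t) (Y_ := fun t => RX ++ F_ t)).
- by apply: seq_lim_cat => //; exact: seq_lim_cst.
- by apply: seq_lim_cat => //; exact: seq_lim_cst.
- by apply: filterS near_all => t [].
Unshelve. all: by end_near.
Qed.

End BrillNoetherLimit.

Lemma closed_bn_property (R : realType) (g r d n : nat) (G : stable_graph g) :
  closed [set l : @cone R g G | bn_property (cone_graph l) r d n].
Proof.
move=> l; rewrite closureEcvg => -[F FF [Fl bnF]].
have [U [U_ultra FU]] := ultraFilterLemma FF.
pose L (l' : @cone R g G) (e : edge (numbered_graph (@ends g G))) : R := set_val l' 0 e.
have L_cvg e : L^~ e @ U --> L l e.
  have : continuous (L^~ e).
    move=> l'; apply: (@continuous_comp _ _ _ _ (fun v : 'rV[R]_(nb_edge G) => v 0 e)).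
      exact: initial_continuous.
    exact: coord_continuous.
  move=> /(_ l) Lc; apply: cvg_trans Lc => A /= LA.
  by apply: FU; exact: (Fl _ LA).
have := @bn_property_limit _ U U_ultra R _ L (L l) (stable_graph_connected G)
  (@cone_ge0 R g G) (@cone_ge0 R g G l) L_cvg r d n.
apply.
by apply: FU; apply: bnF => l'.
Qed.

Lemma isometric_sym (R : realType) (Gam Gam' : metric_graph R) :
  isometric Gam Gam' -> isometric Gam' Gam.
Proof.
by move=> [f [h fK hK] fd]; exists h; [exists f|move=> x y; rewrite -fd !hK].
Qed.

(** [Mg_bn_rank] is evaluated on the chosen representative of the class, which is only isometric to
    [cone_graph l]; isometry invariance bridges the gap. *)
Lemma Mg_bn_rank_geP (R : realType) (g r d n : nat) (G : stable_graph g)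
    (l : @cone R g G) :
  n%:Z <= Mg_bn_rank r d (cone_map l) <-> bn_property (cone_graph l) r d n.
Proof.
rewrite /Mg_bn_rank -lock.
pose p : cones R g := existT (fun G => @cone R g G : Type) G l.
pose q : cones R g := repr (\pi_(Mg_met R g) p)%qT.
have /asboolW iso : cones_isometric q p.
  apply/(@eqquotP _ _ {eq_quot (@cones_isometric R g)}%qT).
  exact: (reprK (\pi_(Mg_met R g) p)%qT).
rewrite bn_rank_geP; split; apply: bn_property_isom => //.
exact: isometric_sym.
Qed.

Theorem theorem1p6 (R : realType) (g r d : nat) (rho : int) :
  open [set x : Mg_met R g | Mg_bn_rank r d x < rho].
Proof.
(* A negative integer is at most -1, which bounds the Brill-Noether rank below, so the set is then
   empty; otherwise [rho] is a natural number and [bn_property] applies. *)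
apply/Mg_met_openP => G; have [rho0|rho0] := ltP rho 0.
  rewrite (_ : _ @^-1` _ = set0); first exact: open0.
  apply/seteqP; split=> // l /=; rewrite /Mg_bn_rank -lock.
  set Gam := cones_graph _; have := bn_rank_geN1 Gam r d; lia.
rewrite (_ : _ @^-1` _ =
    ~` [set l : @cone R g G | bn_property (cone_graph l) r d `|rho|%N]).
  by apply: closed_openC; exact: closed_bn_property.
by apply/seteqP; split=> l /=; rewrite -Mg_bn_rank_geP gez0_abs // ltNge => /negP.
Qed.
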